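(* Let $a>0$ be a real number and let $F$ be an admissible finite set of positive integers. Then the linear combinations of the polynomials $c_n^{a;F}$, $n\in\sigma_F$, are dense in $L^2(\omega_{a;F})$, where $\omega_{a;F}$ is the positive measure $$\omega_{a;F}=\sum_{x=0}^\infty\frac{a^x}{x!\,\Omega_F^a(x)\,\Omega_F^a(x+1)}\,\delta_x .$$ Hence $c_n^{a;F}$, $n\in\sigma_F$, are exceptional Charlier polynomials, that is, they are orthogonal and complete with respect to a positive measure (namely $\omega_{a;F}$).
   Context: Charlier polynomials ($a\ne0$): $c_n^a(x)=\frac1{n!}\sum_{j=0}^n(-a)^{n-j}\binom nj\binom xj j!$, $n\ge0$. For $F=\{f_1<\cdots<f_k\}$ put $u_F=\sum_{f\in F}f-\binom{k+1}{2}$ and $\sigma_F=\{u_F,u_F+1,u_F+2,\dots\}\setminus\{u_F+f: f\in F\}$. For $n\in\sigma_F$, $c_n^{a;F}(x)$ is the $(k+1)\times(k+1)$ determinant whose first row is $(c^a_{n-u_F}(x+j))_{j=0}^{k}$ and whose $(i+1)$-th row is $(c^a_{f_i}(x+j))_{j=0}^k$, $i=1,\dots,k$. Also $\Omega_F^a(x)=\det\big(c_{f_i}^a(x+j-1)\big)_{i,j=1}^k$. Admissible: write $F=\bigcup_{i=1}^KY_i$ as a disjoint union where the elements of each $Y_i$ are consecutive integers and $1+\max Y_i<\min Y_{i+1}$ for $i=1,\dots,K-1$. $F$ is admissible if every $Y_i$ has an even number of elements. (For $a>0$ and $F$ admissible, $\Omega_F^a(n)\Omega_F^a(n+1)>0$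 for all integers $n\ge0$, so $\omega_{a;F}$ is well defined and positive.) *)

(* Defs.v *)
From HB Require Import structures.
From mathcomp Require Export all_boot all_order all_algebra.
From mathcomp Require Export finmap.
From mathcomp Require Export all_classical all_reals all_analysis.

Set Implicit Arguments.
Unset Strict Implicit.
Unset Printing Implicit Defensive.
Import Order.TTheory GRing.Theory Num.Theory.
Import numFieldNormedType.Exports.

Local Open Scope classical_set_scope.
Local Open Scope ring_scope.

Section Charlier.
Variable R : realType.
Implicit Types (a : R) (n k : nat) (F Y : {fset nat}).

(* The polynomial binom(x, j) = x (x - 1) ... (x - j + 1) / j!. *)
Definition binomX (j : nat) : {poly R} :=
  (j`!%:R)^-1 *: \prod_(i < j) ('X - (i%:R)%:P).

Definition charlier a n : {poly R} :=
  (n`!%:R)^-1 *: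
    \sum_(j < n.+1) ((- a) ^+ (n - j) * 'C(n, j)%:R * j`!%:R) *: binomX j.

(* With s = [:: s_1; ...; s_m], the determinant of the matrix whose i-th row is
   c_{s_i}(x), c_{s_i}(x + 1), ..., c_{s_i}(x + m - 1), as a polynomial in x. *)
Definition charlier_casorati a (s : seq nat) : {poly R} :=
  \det (\matrix_(i < size s, j < size s)
          (charlier a (nth 0%N s i) \Po ('X + (j%:R)%:P))).

(* The elements f_1 < ... < f_k of F. *)
Definition elements F : seq nat := sort leq F.

Definition Omega a F : {poly R} := charlier_casorati a (elements F).

(* When 0 \notin F the sum of F is at least 1 + ... + k = 'C(k.+1, 2), so the
   subtraction on nat does not truncate. *)
Definition u_ F : nat := (\sum_(f <- F) f - 'C(#|` F|.+1, 2))%N.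

Definition sigma F : set nat :=
  [set n | (u_ F <= n)%N] `\` [set (u_ F + f)%N | f in [set` F]].

Definition exc_charlier a F n : {poly R} :=
  charlier_casorati a ((n - u_ F)%N :: elements F).

Definition consecutive Y : Prop :=
  exists m M, (m <= M)%N /\ forall x, (x \in Y) = (m <= x <= M)%N.

Definition admissible F : Prop :=
  exists (K : nat) (Y : nat -> {fset nat}),
    [/\ F = \big[@fsetU nat/fset0]_(i < K) Y i,
        forall i j, (i < j < K)%N -> fdisjoint (Y i) (Y j),
        forall i, (i < K)%N -> consecutive (Y i),
        forall i, (i.+1 < K)%N ->
          (1 + last 0 (elements (Y i)) < head 0 (elements (Y i.+1)))%N
      & forall i, (i < K)%N -> ~~ odd #|` Y i| ].

Definition omega_weight a F (x : nat) : R :=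
  a ^+ x / (x`!%:R * (Omega a F).[x%:R] * (Omega a F).[(x.+1)%:R]).

(* As a mere set function: it is a measure only when the weights are
   nonnegative. *)
Definition omega a F (A : set R) : \bar R :=
  (\sum_(0 <= x <oo) (omega_weight a F x)%:E * \d_(x%:R : measurableTypeR R) A)%E.

End Charlier.

Section OrthogonalComplete.
Variable R : realType.
Variable mu : {measure set (measurableTypeR R) -> \bar R}.
Implicit Types (X : set nat) (p : nat -> {poly R}).

Definition linear_combinations X p : set {poly R} :=
  [set q | exists (s : seq nat) (c : nat -> R),
     [set` s] `<=` X /\ q = \sum_(n <- s) c n *: p n].

Definition dense_in_L2 (A : set {poly R}) : Prop :=
  (forall q, A q -> horner q \in Lfun mu 2%:E) /\
  (forall f : R -> R, f \in Lfun mu 2%:E -> forall e : R, 0 < e ->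
     exists2 q : {poly R}, A q &
       ('N[mu]_2%:E[ (fun x : R => (f x - q.[x])%:E) ] < e%:E)%E).

Definition complete_system X p : Prop :=
  dense_in_L2 (linear_combinations X p).

Definition orthogonal_system X p : Prop :=
  [/\ forall n, X n -> horner (p n) \in Lfun mu 2%:E,
      forall m n, X m -> X n -> m <> n ->
        (\int[mu]_x ((p m).[x] * (p n).[x])%:E = 0)%E
    & forall n, X n -> (\int[mu]_x ((p n).[x] ^+ 2)%:E != 0)%E ].

End OrthogonalComplete.

(* Main.v *)
(* Put K(n, x) = 2F0(-n, -x; -1/a), so that charlier a n takes the value
   (-a)^n / n! K(n, x) at a natural number x, with K symmetric on nat * nat and
   w x = a^x / x! satisfying sum_x w x K(n, x) K(m, x) = delta_nm e^a / w n.
   Let pi(v) be the product of the v - f, f in F; admissibility gives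
   pi >= 0 on nat.  By symmetry of K, the Casorati determinant
   D(v, x) = det [K(v, x+j); K(f_i, x+j)], i.e. the exceptional polynomial of
   index u_F + v at x up to a factor depending on v only, is for fixed x a
   polynomial in v divisible by pi, and D(v, x) / pi(v) are Christoffel's
   orthogonal polynomials for the positive measure w pi:
     sum_v (w v / pi v) D(v, x) D(v, y) = delta_xy N x,
   where N x is a positive multiple of 1 / omega_weight a F x.  Polynomials are
   dense in l^2 (w pi), because pi grows slower than a geometric sequence and
   polynomials are dense in l^2 of every Poisson weight by symmetry of K.  Hence
   the suitably normalized matrix D is unitary: its columns, the exceptional
   polynomials, are orthogonal in L^2(omega), and the normalization of its rows
   is Parseval's identity for point masses, which gives completeness. *)
Require Import Defs.
From mathcomp Require Import measurable_realfun ring lra.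
Set Implicit Arguments.
Unset Strict Implicit.
Unset Printing Implicit Defensive.
Import Order.TTheory GRing.Theory Num.Theory.
Import numFieldNormedType.Exports.
Local Open Scope classical_set_scope.
Local Open Scope ring_scope.

(** * Convergent real series *)

Section Sums.
Variable R : realType.
Implicit Types (f g r : nat -> R) (l : R).

(** A relation instead of a limit operator: one hypothesis carries both the convergence of the
    partial sums and their limit, for terms of any sign. *)
Definition sums f l : Prop := series f @ \oo --> l.

Lemma sums_unique f l l' : sums f l -> sums f l' -> l = l'.
Proof. by move=> fl fl'; apply: (cvg_unique _ fl fl'). Qed.

Lemma eq_sums f g l : f =1 g -> sums f l -> sums g l.
Proof. by move=> /funext ->. Qed.

Lemma sumsD f g l l' :
  sums f l -> sums g l' -> sums (fun x => f x + g x) (l + l').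
Proof.
move=> fl gl; rewrite /sums; have -> : series (fun x => f x + g x) =
  (fun n => series f n + series g n).
  by apply/funext => n; rewrite /series /= big_split.
exact: cvgD.
Qed.

Lemma sumsZ c f l : sums f l -> sums (fun x => c * f x) (c * l).
Proof.
move=> fl; rewrite /sums; have -> : series (fun x => c * f x) =
  (fun n => c * series f n).
  by apply/funext => n; rewrite /series /= mulr_sumr.
by apply: cvgM => //; exact: cvg_cst.
Qed.

Lemma sumsN f l : sums f l -> sums (fun x => - f x) (- l).
Proof.
move=> /(sumsZ (c := -1)); rewrite mulN1r.
by apply: eq_sums => x; rewrite mulN1r.
Qed.

Lemma sumsB f g l l' :
  sums f l -> sums g l' -> sums (fun x => f x - g x) (l - l').
Proof. by move=> fl /sumsN; exact: sumsD. Qed.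

Lemma sums0 : sums (fun=> 0) 0.
Proof.
rewrite /sums; have -> : series (fun=> 0) = (fun=> 0) :> (nat -> R).
  by apply/funext => n; rewrite /series /= big1.
exact: cvg_cst.
Qed.

Lemma sums_sum M (F : nat -> nat -> R) (L : nat -> R) :
  (forall i, (i < M)%N -> sums (F i) (L i)) ->
  sums (fun x => \sum_(i < M) F i x) (\sum_(i < M) L i).
Proof.
elim: M => [_|M IH FL].
  rewrite big_ord0; apply: eq_sums sums0 => x; by rewrite big_ord0.
rewrite big_ord_recr /=.
apply: (@eq_sums (fun x => \sum_(i < M) F i x + F M x)).
  by move=> x; rewrite big_ord_recr.
apply: sumsD; last exact: FL.
by apply: IH => i iM; apply: FL; rewrite ltnS ltnW.
Qed.

Lemma sums_delta x0 c : sums (fun x => if x == x0 then c else 0) c.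
Proof.
rewrite /sums; apply: cvg_near_cst.
near=> n; rewrite /series /= big_mkord.
have x0n : (x0 < n)%N by near: n; exists x0.+1.
rewrite (bigD1 (Ordinal x0n)) //= eqxx big1 ?addr0 // => i.
by rewrite -val_eqE /= => /negbTE ->.
Unshelve. all: by end_near.
Qed.

Lemma sums_shift f l : f 0%N = 0 -> sums (fun x => f x.+1) l -> sums f l.
Proof.
move=> f0 fl; rewrite /sums -cvg_shiftS.
suff -> : [sequence series f n.+1]_n = series (fun x => f x.+1) by [].
by apply/funext => n; rewrite /series /= big_nat_recl // f0 add0r.
Qed.

Lemma series_le_sums f l n :
  (forall x, 0 <= f x) -> sums f l -> \sum_(x < n) f x <= l.
Proof.
move=> f0 fl.
have -> : \sum_(x < n) f x = series f n by rewrite /series /= big_mkord.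
rewrite -(cvg_lim _ fl) //; apply: nondecreasing_cvgn_le; last first.
  by apply/cvg_ex; exists l.
by apply: nondecreasing_series => i _ _.
Qed.

Lemma sums_le_bound f l c :
  (forall n, \sum_(x < n) f x <= c) -> sums f l -> l <= c.
Proof.
move=> fc fl; apply: (@cvgr_to_le _ _ _ _ _ _ c fl).
by near=> n; rewrite /series /= big_mkord.
Unshelve. all: by end_near.
Qed.

Lemma sums_ge0 f l : (forall x, 0 <= f x) -> sums f l -> 0 <= l.
Proof. by move=> f0 /(series_le_sums 0 f0); rewrite big_ord0. Qed.

Lemma sums_gt_eps f l e : sums f l -> 0 < e ->
  exists M, forall n, (M <= n)%N -> l - e < \sum_(x < n) f x.
Proof.
move=> fl e0; have : \forall n \near \oo, l - e < series f n.
  by apply: (cvgr_gt _ fl); rewrite ltrBlDr ltrDl.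
case=> M _ HM; exists M => n Mn; have := HM n Mn.
by rewrite /series /= big_mkord.
Qed.

Lemma sums_sup f l : (forall x, 0 <= f x) ->
  (forall n, \sum_(x < n) f x <= l) ->
  (forall e, 0 < e -> exists n, l - e < \sum_(x < n) f x) -> sums f l.
Proof.
move=> f0 fle fgt; apply/cvgrPdist_lt => e e0.
have [n0 n0P] := fgt e e0.
near=> n; rewrite /series /= big_mkord ger0_norm ?subr_ge0 //.
rewrite ltrBlDr addrC -ltrBlDr; apply: (lt_le_trans n0P).
have n0n : (n0 <= n)%N by near: n; exists n0.
rewrite -!(big_mkord xpredT) (big_cat_nat (n := n0) _ n0n) //=.
by rewrite lerDl sumr_ge0.
Unshelve. all: by end_near.
Qed.

Lemma nneseries_sums f l : sums f l -> (\sum_(0 <= x <oo) (f x)%:E = l%:E)%E.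
Proof.
move=> fl; apply: cvg_lim => //.
have -> : (fun n => \sum_(0 <= k < n) (f k)%:E)%E = EFin \o series f.
  by apply/funext => n; rewrite /= /series /= sumEFin.
by apply: cvg_EFin => //; near=> n.
Unshelve. all: by end_near.
Qed.

Lemma sums_nneseries f : (forall x, 0 <= f x) ->
  (\sum_(0 <= x <oo) (f x)%:E < +oo)%E -> exists l, sums f l.
Proof. by move=> f0 foo; have := nnseries_is_cvg f0 foo; move/cvg_ex. Qed.

Lemma sums_le f g l : (forall x, 0 <= f x <= g x) -> sums g l ->
  exists l', sums f l'.
Proof.
move=> fg gl; apply/cvg_ex.
apply: (@series_le_cvg _ f g); try by move=> n; case/andP: (fg n) => // ? ?;
  exact: le_trans (_ : 0 <= f n) _.
by apply/cvg_ex; exists l.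
Qed.

End Sums.

Arguments sums_delta {R} x0 c.
Arguments sumsZ {R} c {f l} _.

(** * Weighted l2 spaces on the natural numbers *)

Section WeightedL2.
Variable R : realType.
Implicit Types (f g r m : nat -> R) (S : set (nat -> R)) (A : set nat).

(** For a nonnegative weight [m], this says that [f] lies in the closure of [S] in l2(m). Bounding
    every partial sum avoids a separate convergence condition. *)
Definition approximable m S f : Prop := forall e : R, 0 < e ->
  exists2 g, S g & forall n, \sum_(x < n) m x * (f x - g x) ^+ 2 <= e.

Definition delta (x0 x : nat) : R := (x == x0)%:R.

(** The coefficients are total functions, zero outside [A] and from [M] on, so that two combinations
    can be padded to a common length and added. *)
Definition span A (G : nat -> nat -> R) : set (nat -> R) :=
  [set g | exists M (c : nat -> R),
     (forall v, (M <= v)%N \/ ~ A v -> c v = 0) /\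
     forall x, g x = \sum_(v < M) c v * G v x].

Lemma sum_widen M M' (c h : nat -> R) : (M <= M')%N ->
  (forall v, (M <= v)%N -> c v = 0) ->
  \sum_(v < M) c v * h v = \sum_(v < M') c v * h v.
Proof.
move=> MM' c0; rewrite -!(big_mkord xpredT (fun v => c v * h v)).
rewrite (big_cat_nat (n := M) _ MM') //= [X in _ = _ + X]big_nat.
rewrite [X in _ = _ + X]big1 ?addr0 //.
by move=> i /andP[Mi _]; rewrite c0 // mul0r.
Qed.

Lemma span0 A G : span A G (fun=> 0).
Proof. by exists 0%N, (fun=> 0); split=> // x; rewrite big_ord0. Qed.

Lemma spanD A G g h : span A G g -> span A G h -> span A G (fun x => g x + h x).
Proof.
move=> [M [c [c0 gE]]] [M' [c' [c'0 hE]]].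
exists (maxn M M'), (fun v => c v + c' v); split.
  move=> v [|Av]; last by rewrite c0 ?c'0 ?addr0 //; right.
  by rewrite geq_max => /andP[? ?]; rewrite c0 ?c'0 ?addr0 //; left.
move=> x; rewrite gE hE.
rewrite (@sum_widen M (maxn M M') c (G^~ x)) ?leq_maxl //; last first.
  by move=> v ?; apply: c0; left.
rewrite (@sum_widen M' (maxn M M') c' (G^~ x)) ?leq_maxr //; last first.
  by move=> v ?; apply: c'0; left.
by rewrite -big_split /=; apply: eq_bigr => i _; rewrite mulrDl.
Qed.

Lemma spanZ A G a g : span A G g -> span A G (fun x => a * g x).
Proof.
move=> [M [c [c0 gE]]]; exists M, (fun v => a * c v); split.
  by move=> v /c0 ->; rewrite mulr0.
by move=> x; rewrite gE mulr_sumr; apply: eq_bigr => i _; rewrite mulrA.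
Qed.

Lemma approximable_sub m S S' f :
  S `<=` S' -> approximable m S f -> approximable m S' f.
Proof. by move=> SS' fS e /fS[g Sg ge]; exists g => //; exact: SS'. Qed.

(** * From point masses to the whole weighted l2 space *)

Section closure.
Variables (m : nat -> R) (S : set (nat -> R)).
Hypothesis m0 : forall x, 0 <= m x.
Hypothesis SD : forall g h, S g -> S h -> S (fun x => g x + h x).
Hypothesis SZ : forall c g, S g -> S (fun x => c * g x).

(** From (s + t)^2 <= 2 s^2 + 2 t^2, so an error of e/4 for each summand is enough. *)
Lemma approximableD f g : approximable m S f -> approximable m S g ->
  approximable m S (fun x => f x + g x).
Proof.
move=> fS gS e e0; have e4 : 0 < e / 4 by lra.
have [f' Sf' f'e] := fS _ e4; have [g' Sg' g'e] := gS _ e4.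
exists (fun x => f' x + g' x) => [|n]; first exact: SD.
apply: (@le_trans _ _ (2 * \sum_(x < n) m x * (f x - f' x) ^+ 2 +
                       2 * \sum_(x < n) m x * (g x - g' x) ^+ 2)).
  rewrite !mulr_sumr -big_split /=; apply: ler_sum => i _.
  have : 0 <= m i * ((f i - f' i) - (g i - g' i)) ^+ 2.
    by rewrite mulr_ge0 ?sqr_ge0.
  by nra.
by have := f'e n; have := g'e n; lra.
Qed.

Lemma approximableZ c f : approximable m S f ->
  approximable m S (fun x => c * f x).
Proof.
(* Dividing the tolerance by c^2 + 1 rather than c^2 covers the case c = 0. *)
move=> fS e e0; have c0 : 0 < c ^+ 2 + 1 by rewrite ltr_wpDl ?sqr_ge0.
have [g Sg ge] := fS (e / (c ^+ 2 + 1)) (divr_gt0 e0 c0).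
exists (fun x => c * g x) => [|n]; first exact: SZ.
have -> : \sum_(x < n) m x * (c * f x - c * g x) ^+ 2 =
          c ^+ 2 * \sum_(x < n) m x * (f x - g x) ^+ 2.
  by rewrite mulr_sumr; apply: eq_bigr => i _; ring.
apply: (le_trans (ler_wpM2l (sqr_ge0 _) (ge n))).
by rewrite mulrA ler_pdivrMr //; nra.
Qed.

Hypothesis S0 : S (fun=> 0).
Hypothesis Sdelta : forall x0, approximable m S (delta x0).

Lemma approximable_truncation M f :
  approximable m S (fun x => if (x < M)%N then f x else 0).
Proof.
elim: M => [|M IH].
  move=> e e0; exists (fun=> 0) => // n; rewrite big1 ?ltW // => i _.
  by rewrite ltn0 subrr expr0n mulr0.
have -> : (fun x => if (x < M.+1)%N then f x else 0) =
  (fun x => (if (x < M)%N then f x else 0) + f M * delta M x).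
  apply/funext => x; rewrite /delta ltnS.
  by case: ltngtP => [||->]; rewrite ?mulr0 ?mulr1 ?addr0 ?add0r.
by apply: approximableD => //; exact: approximableZ.
Qed.

(** Truncating [f] at [M] costs only a tail of its convergent norm series, and the truncation is a
    finite combination of point masses, which are approximable by hypothesis. *)
Lemma approximable_l2 f l :
  sums (fun x => m x * f x ^+ 2) l -> approximable m S f.
Proof.
move=> fl e e0.
have f0 x : 0 <= m x * f x ^+ 2 by rewrite mulr_ge0 ?sqr_ge0.
have [M HM] := sums_gt_eps fl (divr_gt0 e0 (ltr0n R 4)).
pose h x := if (x < M)%N then f x else 0.
have [g Sg ge] := approximable_truncation M f (divr_gt0 e0 (ltr0n R 4)).
exists g => // n.
apply: (@le_trans _ _ (2 * \sum_(x < n) m x * (f x - h x) ^+ 2 +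
                       2 * \sum_(x < n) m x * (h x - g x) ^+ 2)).
  rewrite !mulr_sumr -big_split /=; apply: ler_sum => i _.
  have : 0 <= m i * ((f i - h i) - (h i - g i)) ^+ 2.
    by rewrite mulr_ge0 ?sqr_ge0.
  by nra.
have H1 : \sum_(x < n) m x * (f x - h x) ^+ 2 <= e / 4.
  apply: (@le_trans _ _ (\sum_(x < maxn M n) m x * (f x - h x) ^+ 2)).
    rewrite -!(big_mkord xpredT (fun x => m x * (f x - h x) ^+ 2)).
    rewrite (big_cat_nat (n := n) (p := maxn M n)) ?leq_maxr //= lerDl.
    by apply: sumr_ge0 => i _; rewrite mulr_ge0 ?sqr_ge0.
  have := series_le_sums (maxn M n) f0 fl; have := HM M (leqnn M).
  suff -> : \sum_(x < maxn M n) m x * (f x - h x) ^+ 2 =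
    \sum_(x < maxn M n) m x * f x ^+ 2 - \sum_(x < M) m x * f x ^+ 2 by lra.
  rewrite -!(big_mkord xpredT (fun x => m x * (f x - h x) ^+ 2)).
  rewrite -!(big_mkord xpredT (fun x => m x * f x ^+ 2)).
  rewrite [LHS](big_cat_nat (n := M)) ?leq_maxl //=.
  rewrite [X in _ = X - _](big_cat_nat (n := M)) ?leq_maxl //=.
  rewrite [X in X + _ = _]big_nat big1 ?add0r; last first.
    by move=> i /andP[_ iM]; rewrite /h iM subrr expr0n mulr0.
  rewrite [RHS]addrAC subrr add0r; apply: eq_big_nat => i /andP[Mi _].
  by rewrite /h ltnNge Mi subr0.
by have := ge n; rewrite -/h; lra.
Qed.

End closure.

(** * Parseval's identity and duality of orthogonal systems *)

Section duality.
Variables (r N : nat -> R) (P : nat -> nat -> R).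
Hypothesis N0 : forall x, 0 < N x.
Hypothesis orthP : forall x y,
  sums (fun v => r v * (P x v * P y v)) (if x == y then N x else 0).

(** Expands the squared distance from [f] to a finite combination, [al x] being the inner product of
    [f] with [P x]. Each index contributes a quadratic in [c x], extremal at [al x / N x]. *)
Lemma sums_sqr_sub f nf (al : nat -> R) M (c : nat -> R) :
  sums (fun v => r v * f v ^+ 2) nf ->
  (forall x, sums (fun v => r v * (f v * P x v)) (al x)) ->
  sums (fun v => r v * (f v - \sum_(x < M) c x * P x v) ^+ 2)
       (nf - \sum_(x < M) (2 * c x * al x - c x ^+ 2 * N x)).
Proof.
move=> fnf fal; set g := fun v => \sum_(x < M) c x * P x v.
have gP y : (y < M)%N -> sums (fun v => r v * (g v * P y v)) (c y * N y).
  move=> yM.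
  apply: (@eq_sums _ (fun v => \sum_(x < M) c x * (r v * (P x v * P y v)))).
    by move=> v; rewrite /g mulr_suml mulr_sumr; apply: eq_bigr => i _; ring.
  rewrite (_ : c y * N y =
    \sum_(x < M) c x * (if x == y :> nat then N x else 0)).
    by apply: (@sums_sum _ M (fun x v => c x * (r v * (P x v * P y v)))
       (fun x => c x * (if x == y :> nat then N x else 0))) => i _;
      apply: sumsZ.
  rewrite (bigD1 (Ordinal yM)) //= eqxx big1 ?addr0 // => i.
  by rewrite -val_eqE /= => /negbTE ->; rewrite mulr0.
apply: (@eq_sums _ (fun v => r v * f v ^+ 2 - \sum_(x < M)
   (2 * c x * (r v * (f v * P x v)) - c x * (r v * (g v * P x v))))).
  move=> v; rewrite -/(g v) sumrB.
  have -> : \sum_(x < M) 2 * c x * (r v * (f v * P x v)) = 2 * r v * f v * g v.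
    by rewrite /g mulr_sumr; apply: eq_bigr => i _; ring.
  have -> : \sum_(x < M) c x * (r v * (g v * P x v)) = r v * g v * g v.
    by rewrite {3}/g mulr_sumr; apply: eq_bigr => i _; ring.
  by ring.
apply: sumsB => //.
apply: (@sums_sum _ M (fun x v => 2 * c x * (r v * (f v * P x v)) -
    c x * (r v * (g v * P x v))) (fun x => 2 * c x * al x - c x ^+ 2 * N x)).
move=> i iM; apply: sumsB; first exact: sumsZ.
by rewrite expr2 -mulrA; apply: sumsZ; exact: gP.
Qed.

Hypothesis r0 : forall v, 0 <= r v.

(** The choice c = al / N gives Bessel's inequality. Conversely, a combination within e/2 of [f]
    forces the Bessel sums above nf - e, since the coefficients al / N do at least as well as any
    others. *)
Lemma parseval f nf (al : nat -> R) :
  sums (fun v => r v * f v ^+ 2) nf ->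
  (forall x, sums (fun v => r v * (f v * P x v)) (al x)) ->
  approximable r (span setT P) f ->
  sums (fun x => al x ^+ 2 / N x) nf.
Proof.
move=> fnf fal fS; have Nn x : N x != 0 by rewrite gt_eqF.
apply: sums_sup.
- by move=> x; rewrite divr_ge0 ?sqr_ge0 ?ltW.
- move=> M.
  have /sums_ge0 := sums_sqr_sub (M := M) (c := fun x => al x / N x) fnf fal.
  rewrite subr_ge0.
  rewrite (eq_bigr (fun x : 'I_M => al x ^+ 2 / N x)); last first.
    by move=> x _; have := Nn x; move=> ?; field.
  by apply => v; rewrite mulr_ge0 ?sqr_ge0.
move=> e e0; have [g [M [c [_ gE]]] ge] := fS _ (divr_gt0 e0 (ltr0n R 2)).
exists M; have := sums_sqr_sub (M := M) (c := c) fnf fal.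
under [X in sums X _]eq_fun do rewrite -gE.
move=> /(sums_le_bound ge).
have : \sum_(x < M) (2 * c x * al x - c x ^+ 2 * N x) <=
       \sum_(x < M) al x ^+ 2 / N x.
  apply: ler_sum => x _; rewrite ler_pdivlMr // -subr_ge0.
  have -> : al x ^+ 2 - (2 * c x * al x - c x ^+ 2 * N x) * N x =
    (al x - c x * N x) ^+ 2 by ring.
  exact: sqr_ge0.
by lra.
Qed.

Hypothesis approx_delta : forall x0, approximable r (span setT P) (delta x0).

(** Parseval for the point mass at [v0], whose squared norm is [r v0] and whose inner product with
    [P x] is [r v0 * P x v0]. *)
Lemma dual_norm v0 : 0 < r v0 -> sums (fun x => P x v0 ^+ 2 / N x) (r v0)^-1.
Proof.
move=> rv0; have rn : r v0 != 0 by rewrite gt_eqF.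
have d v : delta v0 v = if v == v0 then 1 else 0 by rewrite /delta; case: eqP.
have : sums (fun x => (r v0 * P x v0) ^+ 2 / N x) (r v0).
  apply: (parseval _ _ (approx_delta v0)) => [|x].
    apply: eq_sums (sums_delta v0 (r v0)) => v; rewrite d.
    by case: eqP => [->|_]; ring.
  apply: eq_sums (sums_delta v0 (r v0 * P x v0)) => v; rewrite d.
  by case: eqP => [->|_]; ring.
move=> /(sumsZ ((r v0)^-1 ^+ 2)).
rewrite (_ : _ * r v0 = (r v0)^-1); last by field.
apply: eq_sums => x; have := N0 x => /gt_eqF/negbT ?; by field; apply/andP.
Qed.

(** For a complete orthogonal system, orthogonality of the rows of [P] passes to its columns. Off
    the diagonal this is polarization: the point masses divided by their weights give a function
    with inner products [P x v0 + P x v1], and the two diagonal identities are subtracted. *)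
Lemma dual_orthogonality v0 v1 : 0 < r v0 -> 0 < r v1 ->
  sums (fun x => (P x v0 * P x v1) / N x) (if v0 == v1 then (r v0)^-1 else 0).
Proof.
move=> rv0 rv1; case: eqP => [<-|/eqP v01].
  exact: dual_norm.
have rn0 : r v0 != 0 by rewrite gt_eqF.
have rn1 : r v1 != 0 by rewrite gt_eqF.
pose f v := (r v0)^-1 * delta v0 v + (r v1)^-1 * delta v1 v.
have fE v : f v =
  if v == v0 then (r v0)^-1 else if v == v1 then (r v1)^-1 else 0.
  rewrite /f /delta; case: (eqVneq v v0) => [->|vv0].
    by rewrite (negbTE v01) /=; ring.
  by case: eqP => _ /=; ring.
have : sums (fun x => (P x v0 + P x v1) ^+ 2 / N x) ((r v0)^-1 + (r v1)^-1).
  apply: (@parseval f) => [|x|].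
  - apply: eq_sums (sumsD (sums_delta v0 (r v0)^-1) (sums_delta v1 (r v1)^-1)).
    move=> v; rewrite fE; case: (eqVneq v v0) => [->|vv0].
      by rewrite (negbTE v01); field.
    by case: eqP => [->|_]; field.
  - apply: eq_sums (sumsD (sums_delta v0 (P x v0)) (sums_delta v1 (P x v1))).
    move=> v; rewrite fE; case: (eqVneq v v0) => [->|vv0].
      by rewrite (negbTE v01); field.
    by case: eqP => [->|_]; field.
  - by apply: approximableD => //; try exact: spanD; apply: approximableZ => //;
      exact: spanZ.
move=> /sumsB /(_ (dual_norm rv0)) /sumsB /(_ (dual_norm rv1)).
move=> /(sumsZ (2^-1)).
rewrite (_ : 2^-1 * _ = 0); last by ring.
apply: eq_sums => x; have := N0 x => /gt_eqF/negbT ?; by field.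
Qed.

End duality.

(** The last hypothesis is Parseval's identity for the point mass at [x0] in the orthogonal system
    [G]. Its partial Fourier sum leaves the error m(x0) - m(x0)^2 s, where s is the partial sum of
    that series, and this tends to 0. *)
Lemma approximable_delta m r (G : nat -> nat -> R) x0 :
  (forall x, 0 <= m x) -> 0 < m x0 -> (forall v, 0 <= r v) ->
  (forall v v', 0 < r v -> 0 < r v' ->
    sums (fun x => m x * (G v x * G v' x)) (if v == v' then (r v)^-1 else 0)) ->
  sums (fun v => r v * G v x0 ^+ 2) (m x0)^-1 ->
  approximable m (span [set v | 0 < r v] G) (delta x0).
Proof.
move=> m0 mx0 r0 orthG normG e e0.
have mn : m x0 != 0 by rewrite gt_eqF.
have e0' : 0 < e / m x0 ^+ 2 by rewrite divr_gt0 // exprn_gt0.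
have [M HM] := sums_gt_eps normG e0'.
(* These are the Fourier coefficients of the point mass; the factor [r v] makes them vanish off the
   index set of the span. *)
pose c v := if (v < M)%N then m x0 * r v * G v x0 else 0.
pose g x := \sum_(v < M) c v * G v x.
exists g.
  exists M, c; split => // v [Mv|rv]; first by rewrite /c ltnNge Mv.
  have -> : c v = (if (v < M)%N then m x0 * r v * G v x0 else 0) by [].
  have -> : r v = 0 by apply/eqP; rewrite eq_le r0 andbT leNgt; apply/negP.
  by rewrite mulr0 mul0r if_same.
have cg v : (v < M)%N -> sums (fun x => m x * (c v * G v x * g x))
    (m x0 ^+ 2 * (r v * G v x0 ^+ 2)).
  move=> vM; have [rv|rv] := eqVneq (r v) 0.
    rewrite rv mul0r mulr0; apply: eq_sums (@sums0 R) => x.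
    by rewrite /c vM rv !(mulr0, mul0r).
  have rv0 : 0 < r v by rewrite lt_neqAle eq_sym rv r0.
  apply: (@eq_sums _ (fun x => \sum_(v' < M)
      c v * c v' * (m x * (G v x * G v' x)))).
    by move=> x; rewrite /g !mulr_sumr; apply: eq_bigr => i _; ring.
  rewrite (_ : m x0 ^+ 2 * _ = \sum_(v' < M)
      if v' == v :> nat then c v * c v' * (r v)^-1 else 0).
    apply: (@sums_sum _ M (fun v' x => c v * c v' * (m x * (G v x * G v' x)))
      (fun v' => if v' == v then c v * c v' * (r v)^-1 else 0)) => v' v'M.
    have [rv'|rv'] := eqVneq (r v') 0.
      have cv' : c v' = 0 by rewrite /c v'M rv' mulr0 mul0r.
      rewrite cv' mulr0 mul0r if_same.
      by apply: eq_sums (@sums0 R) => x; rewrite mul0r.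
    have rv'0 : 0 < r v' by rewrite lt_neqAle eq_sym rv' r0.
    have := sumsZ (c v * c v') (orthG _ _ rv0 rv'0).
    by rewrite eq_sym; case: eqP => //; rewrite mulr0.
  rewrite (bigD1 (Ordinal vM)) //= eqxx big1 ?addr0.
    by rewrite /c vM; field.
  by move=> i; rewrite -val_eqE /= => /negbTE ->.
have gg : sums (fun x => m x * g x ^+ 2)
    (\sum_(v < M) m x0 ^+ 2 * (r v * G v x0 ^+ 2)).
  apply: (@eq_sums _ (fun x => \sum_(v < M) m x * (c v * G v x * g x))).
    by move=> x; rewrite expr2 {2}/g mulr_suml mulr_sumr.
  exact: (@sums_sum _ M (fun v x => m x * (c v * G v x * g x))
    (fun v => m x0 ^+ 2 * (r v * G v x0 ^+ 2))).
have gx0 : g x0 = m x0 * \sum_(v < M) r v * G v x0 ^+ 2.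
  rewrite /g mulr_sumr; apply: eq_bigr => i _; rewrite /c ltn_ord; ring.
have : sums (fun x => m x * (delta x0 x - g x) ^+ 2)
    (m x0 - 2 * m x0 * g x0 + \sum_(v < M) m x0 ^+ 2 * (r v * G v x0 ^+ 2)).
  apply: eq_sums (sumsD (sums_delta x0 (m x0 - 2 * m x0 * g x0)) gg) => x.
  by rewrite /delta; case: eqP => [->|_]; rewrite ?mulr0n ?mulr1n; ring.
rewrite gx0 -mulr_sumr => gl n.
apply: (le_trans (series_le_sums n _ gl)).
  by move=> x; rewrite mulr_ge0 ?sqr_ge0 .
have := HM M (leqnn M); set s := \sum_(_ < _) _.
rewrite ltrBlDr -ltrBlDl ltr_pdivlMr ?exprn_gt0 // => H.
apply: le_trans (ltW H); rewrite le_eqVlt; apply/orP; left; apply/eqP; by field.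
Qed.

End WeightedL2.

(** * The Charlier kernel *)

Section CharlierKernel.
Variables (R : realType) (a : R).
Hypothesis a_gt0 : 0 < a.
Implicit Types (n m x j : nat).

Definition poisson x : R := a ^+ x / x`!%:R.

(** The function K(n, x). The product of the binomial and the falling factorial is n^_j x^_j / j!,
    which is symmetric in n and x. *)
Definition kernel n x : R :=
  \sum_(j < n.+1) ('C(n, j) * x ^_ j)%:R * (- a) ^- j.

Let aN0 : a != 0. Proof. by rewrite gt_eqF. Qed.
Let NaN0 : - a != 0. Proof. by rewrite oppr_eq0. Qed.
Lemma fact_neq0 n : n`!%:R != 0 :> R.
Proof. by rewrite pnatr_eq0 -lt0n fact_gt0. Qed.

Lemma poisson_gt0 x : 0 < poisson x.
Proof. by rewrite divr_gt0 ?exprn_gt0 // ltr0n fact_gt0. Qed.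

Lemma poissonS x : poisson x.+1 * (x.+1%:R / a) = poisson x.
Proof.
rewrite /poisson factS natrM exprS; have := fact_neq0 x => ?.
have x0 : x.+1%:R != 0 :> R by [].
by field; apply/and3P.
Qed.

Lemma kernel_widen M n x : (n < M)%N ->
  kernel n x = \sum_(j < M) ('C(n, j) * x ^_ j)%:R * (- a) ^- j.
Proof.
move=> nM; rewrite /kernel -!(big_mkord xpredT
  (fun j => ('C(n, j) * x ^_ j)%:R * (- a) ^- j)).
rewrite (big_cat_nat (n := n.+1) _ nM) //= [X in _ = _ + X]big_nat.
rewrite [X in _ = _ + X]big1 ?addr0 // => i /andP[ni _].
by rewrite bin_small // mul0n mul0r.
Qed.

Lemma kernelC n x : kernel n x = kernel x n.
Proof.
rewrite (@kernel_widen (maxn n x).+1) ?ltnS ?leq_maxl //.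
rewrite (@kernel_widen (maxn n x).+1 x) ?ltnS ?leq_maxr //.
apply: eq_bigr => j _; congr (_%:R * _).
by rewrite -!bin_ffact mulnCA.
Qed.

Lemma kernel0n x : kernel 0 x = 1.
Proof. by rewrite /kernel big_ord1 ffactn0 bin0 mul1r expr0 invr1. Qed.

(** Pascal's rule together with x^_(j+1) = x (x-1)^_j. At x = 0 the truncated predecessor is
    harmless because of the factor x. *)
Lemma kernelSn n x : kernel n.+1 x = kernel n x - x%:R / a * kernel n x.-1.
Proof.
rewrite (@kernel_widen n.+2 n) // {1}/kernel.
rewrite [LHS]big_ord_recl [X in _ = X - _]big_ord_recl /= !bin0 -addrA.
congr (_ + _).
rewrite /kernel mulr_sumr -sumrB; apply: eq_bigr => j _.
rewrite /bump /= !add1n binS ffactnS !mulnDl !natrD !natrM exprS.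
have j0 : (- a) ^+ j != 0 by rewrite expf_neq0.
by field; rewrite aN0 ?NaN0 j0.
Qed.

Lemma kernelnS n x : kernel n x.+1 = kernel n x - n%:R / a * kernel n.-1 x.
Proof. by rewrite kernelC kernelSn !(kernelC _ n) !(kernelC _ n.-1). Qed.

Lemma sums_poisson : sums poisson (expR a).
Proof. exact: is_cvg_series_exp_coeff. Qed.

(** Since w(x+1) (x+1)/a = w(x), the operator f(x) -> (x/a) f(x-1) preserves sums against the
    Poisson weight: it is the adjoint of the forward shift. *)
Lemma sums_poisson_shift f l : sums (fun x => poisson x * f x) l ->
  sums (fun x => poisson x * (x%:R / a * f x.-1)) l.
Proof.
move=> fl; apply: sums_shift; first by rewrite mul0r mul0r mulr0.
by apply: eq_sums fl => x; rewrite mulrA poissonS.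
Qed.

(** Induction on [n]: lowering n+1 produces a backward shift, which moves to the other factor as a
    forward shift and lowers m+1 there. What remains is (m+1)/a times the sum for (n, m). *)
Lemma kernel_orthogonality n m :
  sums (fun x => poisson x * (kernel n x * kernel m x))
       (if n == m then expR a / poisson n else 0).
Proof.
have H0 k : sums (fun x => poisson x * kernel k x)
    (if k == 0%N then expR a else 0).
  elim: k => [|k IH].
    by apply: eq_sums sums_poisson => x; rewrite kernel0n mulr1.
  rewrite -[X in sums _ X](subrr (if k == 0%N then expR a else 0)).
  apply: eq_sums (sumsB IH (sums_poisson_shift IH)) => x.
  by rewrite kernelSn mulrBr.
have p0 : poisson 0 = 1 by rewrite /poisson expr0 fact0 divr1.
elim: n m => [|n IH] [|m].
- by rewrite p0 divr1; apply: eq_sums (H0 0%N) => x; rewrite kernel0n mul1r.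
- by apply: eq_sums (H0 m.+1) => x; rewrite kernel0n mul1r.
- by apply: eq_sums (H0 n.+1) => x; rewrite kernel0n mulr1.
pose l := (if n == m.+1 then expR a / poisson n else 0 : R).
have Hs : sums (fun x => poisson x * (kernel n x * kernel m.+1 x.+1))
    (l - m.+1%:R / a * (if n == m then expR a / poisson n else 0)).
  apply: eq_sums (sumsB (IH m.+1) (sumsZ (m.+1%:R / a) (IH m))) => x.
  by rewrite kernelnS /=; ring.
have := sumsB (IH m.+1) (sums_poisson_shift (f := fun x =>
  kernel n x * kernel m.+1 x.+1) Hs).
rewrite opprB addrC subrK eqSS.
have -> : m.+1%:R / a * (if n == m then expR a / poisson n else 0) =
  (if n == m then expR a / poisson n.+1 else 0).
  case: eqP => [<-|_]; last by rewrite mulr0.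
  rewrite -(poissonS n); have := poisson_gt0 n.+1 => /gt_eqF/negbT ?.
  have n0 : n.+1%:R != 0 :> R by [].
  by field; apply/and3P.
(* The successor of x.-1 is x only for x > 0; at x = 0 the shifted term carries a factor 0. *)
apply: eq_sums => x; rewrite (kernelSn n); case: x => [|x] /=; last by ring.
by rewrite !mul0r; ring.
Qed.

Lemma horner_binomX j x : (binomX R j).[x%:R] = 'C(x, j)%:R.
Proof.
rewrite /binomX hornerZ horner_prod.
have -> : \prod_(i < j) ('X - i%:R%:P).[x%:R] = (x ^_ j)%:R :> R.
  elim: j => [|j IH]; first by rewrite big_ord0.
  rewrite big_ord_recr /= IH hornerXsubC ffactnSr natrM.
  have [jx|xj] := leqP j x; first by rewrite natrB.
  by rewrite ffact_small // !mul0r.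
rewrite -bin_ffact natrM; have := fact_neq0 j => ?; by field.
Qed.

Lemma horner_charlier n x :
  (charlier a n).[x%:R] = (- a) ^+ n / n`!%:R * kernel n x.
Proof.
rewrite /charlier hornerZ horner_sum [_ ^+ n / _]mulrC -mulrA; congr (_ * _).
rewrite /kernel mulr_sumr; apply: eq_bigr => j _.
rewrite hornerZ horner_binomX.
rewrite -bin_ffact !natrM.
have -> : (- a) ^+ (n - j) = (- a) ^+ n * (- a) ^- j.
  by rewrite expfB_cond // (negbTE NaN0) add0n -ltnS.
by ring.
Qed.

Lemma size_binomX j : size (binomX R j) = j.+1.
Proof.
rewrite size_scale ?invr_eq0 ?fact_neq0 //.
rewrite -(big_mkord xpredT (fun i => 'X - i%:R%:P)) /=.
rewrite -(big_map (fun i : nat => i%:R) xpredT (fun c => 'X - c%:P)).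
by rewrite size_prod_XsubC size_map size_iota subn0.
Qed.

Lemma lead_coef_binomX j : lead_coef (binomX R j) = j`!%:R^-1.
Proof.
by rewrite lead_coefZ (monicP (monic_prod_XsubC _ _ _)) mulr1.
Qed.

Lemma size_charlier_le n : (size (charlier a n) <= n.+1)%N.
Proof.
apply: (leq_trans (size_scale_leq _ _)); apply: (leq_trans (size_sum _ _ _)).
apply/bigmax_leqP => j _; apply: (leq_trans (size_scale_leq _ _)).
by rewrite size_binomX.
Qed.

Lemma coef_charlier n : (charlier a n)`_n = n`!%:R^-1.
Proof.
rewrite coefZ coef_sum big_ord_recr /= big1 ?add0r; last first.
  move=> j _; rewrite coefZ [X in _ * X]nth_default ?mulr0 //.
  by rewrite size_binomX.
rewrite coefZ subnn expr0 binn !mul1r.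
have -> : (binomX R n)`_n = n`!%:R^-1.
  by rewrite -lead_coef_binomX /lead_coef size_binomX.
by rewrite divff ?mulr1 // fact_neq0.
Qed.

(** K(n, x) as a polynomial in x, of exact degree n; by symmetry it also makes K(v, n) a polynomial
    in v. *)
Definition kernel_poly n : {poly R} := ((- a) ^+ n / n`!%:R)^-1 *: charlier a n.

Lemma horner_kernel_poly n x : (kernel_poly n).[x%:R] = kernel n x.
Proof.
rewrite hornerZ horner_charlier mulrA mulVf ?mul1r //.
by rewrite mulf_neq0 ?expf_neq0 // invr_eq0 fact_neq0.
Qed.

Lemma coef_kernel_poly n : (kernel_poly n)`_n = (- a) ^- n.
Proof.
rewrite coefZ coef_charlier; have := fact_neq0 n => ?.
have n0 : (- a) ^+ n != 0 by rewrite expf_neq0.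
by field; apply/andP.
Qed.

Lemma size_kernel_poly n : size (kernel_poly n) = n.+1.
Proof.
apply/eqP; rewrite eqn_leq; apply/andP; split.
  exact: leq_trans (size_scale_leq _ _) (size_charlier_le n).
rewrite ltnNge; apply/negP => /leq_sizeP/(_ n (leqnn n)).
by rewrite coef_kernel_poly => /eqP;
  rewrite invr_eq0 expf_eq0 (negbTE NaN0) andbF.
Qed.

End CharlierKernel.

(** * Polynomial sequences with one member of each degree *)

Section Graded.
Variables (R : realType) (q : nat -> {poly R}).
Hypothesis size_q : forall n, size (q n) = n.+1.

Lemma graded_basis M (p : {poly R}) : (size p <= M)%N ->
  exists c : nat -> R, p = \sum_(n < M) c n *: q n.
Proof.
elim: M p => [|M IH] p pM.
  exists (fun=> 0); rewrite big_ord0; apply/eqP.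
  by rewrite -size_poly_eq0 -leqn0.
pose b := p`_M / (q M)`_M.
have qM : (q M)`_M != 0.
  have : lead_coef (q M) != 0 by rewrite lead_coef_eq0 -size_poly_eq0 size_q.
  by rewrite /lead_coef size_q.
have [|c cE] := IH (p - b *: q M).
  apply/leq_sizeP => j; rewrite leq_eqVlt coefB coefZ => /orP[/eqP <-|Mj].
    by rewrite /b divfK // subrr.
  by rewrite !nth_default ?mulr0 ?subr0 // ?size_q // (leq_trans pM).
exists (fun n => if n == M then b else c n).
rewrite big_ord_recr /= eqxx -[LHS](subrK (b *: q M)) cE; congr (_ + _).
by apply: eq_bigr => i _; rewrite ltn_eqF.
Qed.

Lemma coef_graded_sum M (c : nat -> R) :
  (\sum_(n < M.+1) c n *: q n)`_M = c M * (q M)`_M.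
Proof.
rewrite coef_sum big_ord_recr /= coefZ big1 ?add0r // => i _.
by rewrite coefZ nth_default ?mulr0 // size_q.
Qed.

End Graded.

(** * Casorati determinants and the dual orthogonal polynomials *)

Section Casorati.
Variables (R : realType) (a : R).
Hypothesis a_gt0 : 0 < a.
Implicit Types (s : seq nat) (v x y : nat).

Let aN0 : a != 0. Proof. by rewrite gt_eqF. Qed.
Let NaN0 : - a != 0. Proof. by rewrite oppr_eq0. Qed.

Definition kernel_mx s x : 'M[R]_(size s) :=
  \matrix_(i, j) kernel a (nth 0%N s i) (x + j)%N.

Definition normalization s : R := \prod_(f <- s) ((- a) ^+ f / f`!%:R).

Lemma normalization_neq0 s : normalization s != 0.
Proof.
rewrite /normalization prodf_seq_neq0; apply/allP => f _.
by rewrite implyTb mulf_neq0 ?expf_neq0 // invr_eq0 fact_neq0.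
Qed.

(** The factors (-a)^f / f! are pulled out of the rows as a diagonal matrix. *)
Lemma horner_casorati s x :
  (charlier_casorati a s).[x%:R] = normalization s * \det (kernel_mx s x).
Proof.
rewrite /charlier_casorati -[LHS]/(horner_eval x%:R _) -det_map_mx.
pose d : 'rV[R]_(size s) :=
  \row_i ((- a) ^+ nth 0%N s i / (nth 0%N s i)`!%:R).
have -> : normalization s = \det (diag_mx d).
  rewrite det_diag /normalization (big_nth 0%N) big_mkord.
  by apply: eq_bigr => i _; rewrite mxE.
rewrite -det_mulmx; congr (\det _); apply/matrixP => i j.
rewrite mul_diag_mx !mxE /= /horner_eval horner_comp.
by rewrite hornerD hornerX hornerC -natrD horner_charlier.
Qed.

Section FixedDegrees.
Variable fs : seq nat.
Hypothesis fs_uniq : uniq fs.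
Let k := size fs.

Definition node_poly : {poly R} := \prod_(f <- fs) ('X - f%:R%:P).

Hypothesis node_ge0 : forall v, 0 <= node_poly.[v%:R].

(** Cofactors along the first row do not see that row, so the degree 0 there is a mere
    placeholder. *)
Definition dual_cofactor x (j : 'I_k.+1) : R :=
  cofactor (kernel_mx (0%N :: fs) x) ord0 j.

(** The determinant D(v, x) as a polynomial in v, by expansion along its first row and symmetry of
    K. *)
Definition dual_poly x : {poly R} :=
  \sum_(j < k.+1) dual_cofactor x j *: kernel_poly a (x + j)%N.

Lemma horner_dual_poly x v :
  (dual_poly x).[v%:R] = \det (kernel_mx (v :: fs) x).
Proof.
rewrite (expand_det_row _ ord0) /dual_poly horner_sum; apply: eq_bigr => j _.
rewrite hornerZ horner_kernel_poly // mulrC; congr (_ * _).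
  by rewrite mxE kernelC.
rewrite /dual_cofactor /cofactor; congr (_ * \det _).
by apply/matrixP => i j'; rewrite !mxE.
Qed.

Lemma dual_cofactor0 x : dual_cofactor x ord0 = \det (kernel_mx fs x.+1).
Proof.
rewrite /dual_cofactor /cofactor expr0 mul1r; congr (\det _).
by apply/matrixP => i j; rewrite !mxE /= /bump /= !add1n addSnnS.
Qed.

Lemma dual_cofactor_max x :
  dual_cofactor x ord_max = (-1) ^+ k * \det (kernel_mx fs x).
Proof.
rewrite /dual_cofactor /cofactor add0n; congr (_ * \det _).
by apply/matrixP => i j; rewrite !mxE lift_max.
Qed.

(** At a node two rows of the determinant coincide. *)
Lemma dual_poly_root x f : f \in fs -> (dual_poly x).[f%:R] = 0.
Proof.
move=> ffs; rewrite horner_dual_poly.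
have fk : (index f fs < k)%N by rewrite index_mem.
apply: (@determinant_alternate _ _ _ ord0 (lift ord0 (Ordinal fk))) => // j.
by rewrite !mxE /= nth_index.
Qed.

Lemma node_poly_root v : (node_poly.[v%:R] == 0) = (v \in fs).
Proof.
rewrite -/(root node_poly v%:R) /node_poly.
rewrite -(big_map (fun f : nat => f%:R) xpredT (fun c => 'X - c%:P)).
rewrite root_prod_XsubC; apply/mapP/idP => [[f ffs /eqP]|vfs].
  by rewrite eqr_nat => /eqP ->.
by exists v.
Qed.

Lemma size_node_poly : size node_poly = k.+1.
Proof.
rewrite /node_poly -(big_map (fun f : nat => f%:R) xpredT (fun c => 'X - c%:P)).
by rewrite size_prod_XsubC size_map.
Qed.

Lemma node_poly_monic : node_poly \is monic.
Proof. exact: monic_prod_XsubC. Qed.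

Lemma node_poly_dvd (p : {poly R}) : (forall f, f \in fs -> p.[f%:R] = 0) ->
  p = p %/ node_poly * node_poly.
Proof.
move=> p0; apply/eqP; rewrite -dvdp_eq.
rewrite /node_poly -(big_map (fun f : nat => f%:R) xpredT (fun c => 'X - c%:P)).
apply: uniq_roots_dvdp; last first.
  by rewrite uniq_rootsE map_inj_uniq // => i j /eqP; rewrite eqr_nat => /eqP.
by apply/allP => _ /mapP[f ffs ->]; rewrite /root p0.
Qed.

(** Expanding [p] in the K(n, .), n <= x, leaves only its coordinate along K(x, .), which is the
    leading coefficient divided by that of K(x, .), namely (-a)^-x. *)
Lemma sums_low_degree (p : {poly R}) x y : (size p <= x.+1)%N -> (x <= y)%N ->
  sums (fun v => poisson a v * (p.[v%:R] * kernel a y v))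
    (if y == x then p`_x * (- a) ^+ x * (expR a / poisson a x) else 0).
Proof.
move=> px xy.
have [c pE] := graded_basis (size_kernel_poly a_gt0) px.
have -> : p`_x * (- a) ^+ x = c x.
  rewrite pE coef_graded_sum; last exact: size_kernel_poly.
  by rewrite coef_kernel_poly // divfK // expf_neq0.
apply: (@eq_sums _ (fun v => \sum_(n < x.+1)
    c n * (poisson a v * (kernel a n v * kernel a y v)))).
  move=> v; rewrite pE horner_sum mulr_suml mulr_sumr; apply: eq_bigr => i _.
  by rewrite hornerZ horner_kernel_poly //; ring.
have := @sums_sum _ x.+1 (fun n v => c n * (poisson a v *
  (kernel a n v * kernel a y v))) (fun n => c n *
  (if n == y then expR a / poisson a n else 0)).
rewrite (_ : \sum_(i < x.+1) _ =
  if y == x then c x * (expR a / poisson a x) else 0).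
  by apply => i _; apply: sumsZ; exact: kernel_orthogonality.
rewrite big_ord_recr /= big1 ?add0r => [|i _].
  by rewrite eq_sym; case: eqP => // _; rewrite mulr0.
by rewrite ltn_eqF ?mulr0 // (leq_trans (ltn_ord i)).
Qed.

Lemma sums_low_degree_comb (p : {poly R}) x M (b : nat -> R) :
  (size p <= x.+1)%N ->
  sums (fun v => poisson a v *
      (p.[v%:R] * (\sum_(j < M) b j *: kernel_poly a (x + j)%N).[v%:R]))
    (if (0 < M)%N then
       b 0%N * (p`_x * (- a) ^+ x * (expR a / poisson a x)) else 0).
Proof.
move=> px; apply: (@eq_sums _ (fun v => \sum_(j < M)
    b j * (poisson a v * (p.[v%:R] * kernel a (x + j)%N v)))).
  move=> v; rewrite horner_sum !mulr_sumr; apply: eq_bigr => j _.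
  by rewrite hornerZ horner_kernel_poly //; ring.
have := @sums_sum _ M (fun j v => b j * (poisson a v * (p.[v%:R] *
  kernel a (x + j)%N v))) (fun j => b j * (if (x + j == x)%N
  then p`_x * (- a) ^+ x * (expR a / poisson a x) else 0)).
rewrite (_ : \sum_(i < M) _ = if (0 < M)%N then
       b 0%N * (p`_x * (- a) ^+ x * (expR a / poisson a x)) else 0).
  by apply => j _; apply: sumsZ; apply: sums_low_degree; rewrite // leq_addr.
case: M => [|M]; first by rewrite big_ord0.
rewrite big_ord_recl /= addn0 eqxx big1 ?addr0 // => i _.
by rewrite -[X in _ == X]addn0 eqn_add2l mulr0.
Qed.

(* A linear dependency gives a combination T of K(x, .), ..., K(x+k-1, .)
   divisible by pi; T is orthogonal to T / pi, which has degree < x, so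
   T^2 / pi has zero w-sum and T = 0. *)
Lemma kernel_det_neq0 x : \det (kernel_mx fs x) != 0.
Proof.
(* Transposing makes the dependency one between columns, that is, between the shifts x, ...,
   x+k-1. *)
apply/negP; rewrite -det_tr => /det0P[b b0 bA].
pose b' j := if insub j is Some i then b ord0 i else 0.
have b'E (i : 'I_k) : b' i = b ord0 i.
  by rewrite /b' insubT //= => ?; congr (b _ _); apply: val_inj.
pose T := \sum_(j < k) b' j *: kernel_poly a (x + j)%N.
have Tv v : T.[v%:R] = \sum_(j < k) b' j * kernel a (x + j)%N v.
  rewrite horner_sum; apply: eq_bigr => j _.
  by rewrite hornerZ horner_kernel_poly.
have T0 f : f \in fs -> T.[f%:R] = 0.
  move=> ffs; have fk : (index f fs < k)%N by rewrite index_mem.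
  have := congr1 (fun B : 'rV_k => B ord0 (Ordinal fk)) bA.
  rewrite !mxE Tv => H; rewrite -[RHS]H; apply: eq_bigr => j _.
  by rewrite !mxE b'E /= nth_index // kernelC.
have TE := node_poly_dvd T0; set q := T %/ node_poly in TE.
have sq : (size q <= x)%N.
  have [->|q0] := eqVneq q 0; first by rewrite size_poly0.
  have : (size T <= x + k)%N.
    apply: (leq_trans (size_sum _ _ _)); apply/bigmax_leqP => j _.
    apply: (leq_trans (size_scale_leq _ _)).
    by rewrite size_kernel_poly // -addnS leq_add2l.
  rewrite TE size_Mmonic ?node_poly_monic // size_node_poly addnS /=.
  by rewrite leq_add2r.
have qT : sums (fun v => poisson a v * (q.[v%:R] * T.[v%:R])) 0.
  have := sums_low_degree_comb (M := k) (b := b') (leqW sq).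
  by rewrite (nth_default _ sq) !(mul0r, mulr0) if_same.
have qT0 v : 0 <= poisson a v * (q.[v%:R] * T.[v%:R]).
  rewrite TE hornerM [q.[_] * (_ * _)]mulrA -expr2.
  by rewrite mulr_ge0 ?(ltW (poisson_gt0 _ _)) // mulr_ge0 ?sqr_ge0.
have Tz v : T.[v%:R] = 0.
  have := series_le_sums v.+1 qT0 qT; rewrite big_ord_recr /= => H.
  have H0 : poisson a v * (q.[v%:R] * T.[v%:R]) = 0.
    apply/eqP; rewrite eq_le qT0 andbT; apply: le_trans H.
    by rewrite lerDr sumr_ge0.
  move/eqP: H0; rewrite mulf_eq0 gt_eqF ?poisson_gt0 //= mulf_eq0.
  by case/orP => /eqP // q0; rewrite TE hornerM q0 mul0r.
move/negP: b0; apply; apply/eqP/rowP => i; rewrite mxE.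
(* The inner product of T with K(x+i, .) isolates the coefficient [b' i], which therefore vanishes
   together with T. *)
have : sums (fun v => poisson a v * (kernel a (x + i)%N v * T.[v%:R]))
  (b' i * (expR a / poisson a (x + i)%N)).
  apply: (@eq_sums _ (fun v => \sum_(j < k)
      b' j * (poisson a v * (kernel a (x + i)%N v * kernel a (x + j)%N v)))).
    by move=> v; rewrite Tv !mulr_sumr; apply: eq_bigr => j _; ring.
  have := @sums_sum _ k (fun j v => b' j * (poisson a v *
    (kernel a (x + i)%N v * kernel a (x + j)%N v))) (fun j => b' j *
    (if (x + i == x + j)%N then expR a / poisson a (x + i)%N else 0)).
  rewrite (bigD1 i) //= eqxx big1 ?addr0.
    by apply => j _; apply: sumsZ; exact: kernel_orthogonality.
  move=> j; rewrite -val_eqE eq_sym /= => /negbTE ji.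
  by rewrite eqn_add2l ji mulr0.
move=> bl; 
have b0' : sums (fun v => poisson a v * (kernel a (x + i)%N v * T.[v%:R])) 0.
  by apply: eq_sums (@sums0 R) => v; rewrite Tz !mulr0.
have : expR a / poisson a (x + i)%N != 0.
  by rewrite gt_eqF // divr_gt0 ?expR_gt0 ?poisson_gt0.
move=> /negbTE en; have /eqP := sums_unique bl b0'.
by rewrite mulf_eq0 en orbF b'E => /eqP.
Qed.

Definition dual_quotient x : {poly R} := dual_poly x %/ node_poly.

Lemma dual_polyE x : dual_poly x = dual_quotient x * node_poly.
Proof. by apply: node_poly_dvd => f; exact: dual_poly_root. Qed.

Lemma dual_poly_coef x : (dual_poly x)`_(x + k)%N =
  (-1) ^+ k * \det (kernel_mx fs x) * (- a) ^- (x + k)%N.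
Proof.
rewrite /dual_poly coef_sum big_ord_recr /= big1 ?add0r => [|j _].
  by rewrite coefZ coef_kernel_poly // -dual_cofactor_max.
by rewrite coefZ nth_default ?mulr0 // size_kernel_poly // -addnS leq_add2l.
Qed.

Lemma size_dual_poly x : size (dual_poly x) = (x + k).+1.
Proof.
apply/eqP; rewrite eqn_leq; apply/andP; split.
  apply: (leq_trans (size_sum _ _ _)); apply/bigmax_leqP => j _.
  apply: (leq_trans (size_scale_leq _ _)).
  by rewrite size_kernel_poly // ltnS leq_add2l -ltnS.
rewrite ltnNge; apply/negP => /leq_sizeP/(_ _ (leqnn _))/eqP.
rewrite dual_poly_coef; apply/negP.
by rewrite !mulf_neq0 ?kernel_det_neq0 ?signr_eq0 // invr_eq0 expf_neq0.
Qed.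

(** The degree is exactly x because the top coefficient of D(., x) contains a nonzero Casorati
    determinant; hence the quotients form a graded basis. *)
Lemma size_dual_quotient x : size (dual_quotient x) = x.+1.
Proof.
have := size_dual_poly x; rewrite dual_polyE size_Mmonic ?node_poly_monic //.
  by rewrite size_node_poly addnS /= -addSn => /addIn.
apply/eqP => q0; have := size_dual_poly x.
by rewrite dual_polyE q0 mul0r size_poly0.
Qed.

Lemma dual_quotient_coef x : (dual_quotient x)`_x =
  (-1) ^+ k * \det (kernel_mx fs x) * (- a) ^- (x + k)%N.
Proof.
rewrite -dual_poly_coef.
have -> : (dual_quotient x)`_x = lead_coef (dual_quotient x).
  by rewrite /lead_coef size_dual_quotient.
have -> : (dual_poly x)`_(x + k)%N = lead_coef (dual_poly x).
  by rewrite /lead_coef size_dual_poly.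
by rewrite [in RHS]dual_polyE lead_coef_Mmonic ?node_poly_monic.
Qed.

(* Since x / 0 = 0, this weight vanishes on the nodes. *)
Definition dual_weight v : R := poisson a v / node_poly.[v%:R].

Definition dual_norm2 x : R :=
  \det (kernel_mx fs x) * \det (kernel_mx fs x.+1) *
  (expR a / (a ^+ k * poisson a x)).

Lemma dual_weight_ge0 v : 0 <= dual_weight v.
Proof. by rewrite divr_ge0 // ltW ?poisson_gt0. Qed.

Lemma dual_weight_gt0 v : (0 < dual_weight v) = (v \notin fs).
Proof.
rewrite -node_poly_root lt_neqAle dual_weight_ge0 andbT eq_sym.
by rewrite mulf_eq0 invr_eq0 gt_eqF ?poisson_gt0.
Qed.

(** For y <= x the factor pi of D(v, y) cancels the denominator of the weight, leaving a polynomial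
    of degree y against a combination of K(x, .), ..., K(x+k, .). Only y = x and the first term
    survive: the leading coefficient contributes the determinant at x, the first cofactor the one at
    x+1. *)
Lemma dual_poly_orthogonality x y :
  sums (fun v => dual_weight v * ((dual_poly x).[v%:R] * (dual_poly y).[v%:R]))
       (if x == y then dual_norm2 x else 0).
Proof.
wlog yx : x y / (y <= x)%N => [H|].
  have [/H //|/ltnW/H] := leqP y x; rewrite eq_sym.
  have -> : (if x == y then dual_norm2 y else 0) =
            (if x == y then dual_norm2 x else 0).
    by case: eqP => [->|].
  by apply: eq_sums => v; rewrite [X in _ * X]mulrC.
have sy : (size (dual_quotient y) <= x.+1)%N by rewrite size_dual_quotient.
pose b j := if insub j is Some i then dual_cofactor x i else 0.
have bE (i : 'I_k.+1) : b i = dual_cofactor x i.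
  by rewrite /b insubT //= => ?; congr (dual_cofactor x _); apply: val_inj.
have := sums_low_degree_comb (M := k.+1) (b := b) sy.
rewrite ltn0Sn.
have -> : \sum_(j < k.+1) b j *: kernel_poly a (x + j)%N = dual_poly x.
  by apply: eq_bigr => j _; rewrite bE.
have -> : b 0%N = \det (kernel_mx fs x.+1) by rewrite -dual_cofactor0 -bE.
have -> : \det (kernel_mx fs x.+1) *
   ((dual_quotient y)`_x * (- a) ^+ x * (expR a / poisson a x)) =
   if x == y then dual_norm2 x else 0.
  case: eqP => [<-|/eqP xy]; last first.
    rewrite nth_default ?mul0r ?mulr0 // size_dual_quotient.
    by rewrite ltn_neqAle eq_sym xy yx.
  rewrite dual_quotient_coef /dual_norm2 exprD [(- a) ^+ k]exprNn.
  have ax : (- a) ^+ x != 0 by rewrite expf_neq0.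
  have ak : a ^+ k != 0 by rewrite expf_neq0.
  have sk : (-1) ^+ k != 0 :> R by rewrite signr_eq0.
  have := poisson_gt0 a_gt0 x => /gt_eqF/negbT ?.
  by field; apply/and4P.
apply: eq_sums => v; rewrite /dual_weight.
(* At a node both sides vanish, as D(v, x) does. *)
have [v0|v0] := eqVneq node_poly.[v%:R] 0.
  by rewrite !(dual_polyE x) hornerM v0 !(mulr0, mul0r).
by rewrite (dual_polyE y) hornerM; field.
Qed.

(** A sum of nonnegative terms that is nonzero by the nonvanishing of the determinants. It forces
    consecutive Casorati determinants to have the same sign, whence the positivity of omega. *)
Lemma dual_norm2_gt0 x : 0 < dual_norm2 x.
Proof.
rewrite lt_neqAle eq_sym; apply/andP; split.
  apply: mulf_neq0; first by rewrite mulf_neq0 ?kernel_det_neq0.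
  by rewrite gt_eqF // divr_gt0 ?expR_gt0 // mulr_gt0 ?exprn_gt0 ?poisson_gt0.
have := @dual_poly_orthogonality x x; rewrite eqxx; apply: sums_ge0 => v.
by rewrite mulr_ge0 ?dual_weight_ge0 // -expr2 sqr_ge0.
Qed.

End FixedDegrees.
End Casorati.

(** * Density of polynomials for Poisson weights *)

Section Density.
Variables (R : realType) (a : R).
Hypothesis a_gt0 : 0 < a.

(** By induction from v <= 2^v. The bound allows the weight w pi to be dominated by a Poisson weight
    with a larger parameter. *)
Lemma poly_growth (p : {poly R}) :
  exists C B : R, [/\ 0 < C, 1 <= B & forall v : nat, p.[v%:R] <= C * B ^+ v].
Proof.
suff [C [B [C0 B1 pCB]]] : exists C B : R,
    [/\ 0 < C, 1 <= B & forall v : nat, `|p.[v%:R]| <= C * B ^+ v].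
  by exists C, B; split => // v; apply: le_trans (pCB v); exact: ler_norm.
elim/poly_ind: p => [|p c [C [B [C0 B1 IH]]]].
  by exists 1, 1; split => // v; rewrite horner0 normr0 mul1r exprn_ge0.
exists (C + `|c|), (2 * B); split.
- by rewrite ltr_pwDl.
- by lra.
move=> v; rewrite hornerMXaddC exprMn mulrDl.
have B1v : 1 <= B ^+ v by rewrite exprn_ege1.
have v2 : v%:R <= 2 ^+ v :> R by rewrite -natrX ler_nat ltnW // ltn_expl.
have v21 : 1 <= 2 ^+ v :> R by rewrite exprn_ege1 // ler1n.
apply: (le_trans (ler_normD _ _)); apply: lerD.
  rewrite normrM (ger0_norm (ler0n R v)) [2 ^+ v * _]mulrC mulrA.
  by apply: ler_pM; rewrite ?ler0n.
by rewrite ler_peMr // (le_trans v21) // ler_peMr // (le_trans ler01).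
Qed.

Definition poly_functions : set (nat -> R) :=
  [set g | exists p : {poly R}, forall x : nat, g x = p.[x%:R]].

(* Self-duality of the Charlier kernel turns its row norms into Parseval's
   identity for point masses. *)
Lemma approximable_poisson f M : approximable (poisson a) poly_functions
  (fun x => if (x < M)%N then f x else 0).
Proof.
have S2 : span setT (kernel a) `<=` poly_functions.
  move=> g [K [c [_ gE]]]; exists (\sum_(n < K) c n *: kernel_poly a n) => x.
  rewrite gE horner_sum; apply: eq_bigr => i _.
  by rewrite hornerZ horner_kernel_poly.
have p0 x : 0 <= poisson a x by rewrite ltW ?poisson_gt0.
apply: (@approximable_truncation R) => //.
- move=> g h [p gE] [q hE]; exists (p + q) => x.
  by rewrite gE hE hornerD.
- by move=> c g [p gE]; exists (c *: p) => x; rewrite gE hornerZ.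
- by exists 0 => x; rewrite horner0.
move=> x0; have e0 : expR a != 0 by rewrite gt_eqF ?expR_gt0.
have pn x : poisson a x != 0 by rewrite gt_eqF ?poisson_gt0.
have : approximable (poisson a)
    (span [set v | 0 < poisson a v / expR a] (kernel a)) (delta R x0).
  apply: approximable_delta => //.
  - exact: poisson_gt0.
  - by move=> v; rewrite divr_ge0 // expR_ge0.
  - move=> v v' _ _; rewrite invf_div; exact: kernel_orthogonality.
  have := @kernel_orthogonality _ _ a_gt0 x0 x0; rewrite eqxx.
  move=> /(sumsZ (expR a)^-1).
  rewrite (_ : _ * _ = (poisson a x0)^-1); last first.
    by field; rewrite pn e0.
  by apply: eq_sums => x; rewrite !(kernelC a x0); ring.
apply: approximable_sub => g [K [c [_ gE]]]; apply: S2.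
exists K, (fun v => if (v < K)%N then c v else 0).
split => [v [Kv|[]]|x] //; first by rewrite ltnNge Kv.
by rewrite gE; apply: eq_bigr => i _; rewrite ltn_ord.
Qed.

End Density.

(** * Completeness of the dual polynomials and its transfer to the determinants *)

Section Duality.
Variables (R : realType) (a : R).
Hypothesis a_gt0 : 0 < a.
Variable fs : seq nat.
Hypothesis fs_uniq : uniq fs.
Hypothesis node_ge0 : forall v : nat, 0 <= (node_poly R fs).[v%:R].
Implicit Types v x : nat.

(** The D(., x) span pi times all polynomials, and (w/pi) (d - p pi)^2 = w pi (d/pi - p)^2 off the
    nodes. Since pi(v) <= C B^v, this is at most C times the error of p as an approximation of d/pi
    for the Poisson weight of parameter B a. *)
Lemma approximable_dual_delta v0 :
  approximable (dual_weight a fs)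
    (span setT (fun x v => (dual_poly a fs x).[v%:R])) (delta R v0).
Proof.
have spanE (p : {poly R}) : span setT (fun x v => (dual_poly a fs x).[v%:R])
    (fun v => (p * node_poly R fs).[v%:R]).
  have [c pE] := graded_basis (size_dual_quotient a_gt0 fs_uniq node_ge0)
    (leqnn (size p)).
  exists (size p), (fun v => if (v < size p)%N then c v else 0); split.
    by move=> v [pv|[]//]; rewrite ltnNge pv.
  move=> v; rewrite hornerM [in LHS]pE horner_sum mulr_suml.
  apply: eq_bigr => i _; rewrite ltn_ord dual_polyE // hornerM hornerZ.
  by rewrite mulrA.
have r0 := dual_weight_ge0 a_gt0 node_ge0.
(* A node has weight zero, so the zero polynomial approximates its point mass. *)
have [v0f|v0f] := boolP (v0 \in fs).
  move=> e e0; exists (fun v => (0 * node_poly R fs).[v%:R]).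
    exact: spanE.
  move=> n; rewrite big1 ?ltW // => i _; rewrite mul0r horner0 subr0 /delta.
  have [->|_] := eqVneq (i : nat) v0; last by rewrite expr0n mulr0.
  move: v0f; rewrite -(node_poly_root R) /dual_weight => /eqP ->.
  by rewrite invr0 mulr0 mul0r.
have [C [B [C0 B1 nCB]]] := poly_growth (node_poly R fs).
have Ba : 0 < B * a by rewrite mulr_gt0 // (lt_le_trans _ B1).
move=> e e0; have [g [p gE] ge] := @approximable_poisson _ _ Ba
  (fun v => delta R v0 v / (node_poly R fs).[v%:R]) v0.+1 _ (divr_gt0 e0 C0).
exists (fun v => (p * node_poly R fs).[v%:R]); first exact: spanE.
move=> n; apply: (@le_trans _ _ (C * (e / C))); last first.
  by rewrite mulrCA divff ?mulr1 // gt_eqF.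
apply: le_trans (ler_wpM2l (ltW C0) (ge n)).
rewrite mulr_sumr; apply: ler_sum => i _; rewrite gE hornerM.
have -> : (if (i < v0.+1)%N then delta R v0 i / (node_poly R fs).[i%:R] else 0)
  = delta R v0 i / (node_poly R fs).[i%:R].
  by case: ltnP => // v0i; rewrite /delta gtn_eqF // mul0r.
set d := delta R v0 i; set nd := (node_poly R fs).[i%:R].
have nC : nd <= C * B ^+ i := nCB i.
have p0 : 0 < poisson a i by exact: poisson_gt0.
have pB : poisson (B * a) i = B ^+ i * poisson a i.
  by rewrite /poisson exprMn mulrA.
rewrite /dual_weight -/nd pB.
have [nd0|nd0] := eqVneq nd 0.
  rewrite nd0 invr0 mulr0 mul0r mulr_ge0 ?(ltW C0) // mulr_ge0 ?sqr_ge0 //.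
  by rewrite mulr_ge0 ?(ltW p0) // exprn_ge0 // (le_trans _ B1).
have -> : poisson a i / nd * (d - p.[i%:R] * nd) ^+ 2 =
  nd * (poisson a i * (d / nd - p.[i%:R]) ^+ 2) by field.
rewrite -mulrA [C * _]mulrA; apply: ler_wpM2r => //.
by rewrite mulr_ge0 ?sqr_ge0 // ltW.
Qed.

Lemma casorati_orthogonality v v' : v \notin fs -> v' \notin fs ->
  sums (fun x => \det (kernel_mx a (v :: fs) x) *
                 \det (kernel_mx a (v' :: fs) x) / dual_norm2 a fs x)
       (if v == v' then (dual_weight a fs v)^-1 else 0).
Proof.
rewrite -!(dual_weight_gt0 a_gt0 node_ge0) => rv rv'.
have := @dual_orthogonality R (dual_weight a fs) (dual_norm2 a fs)
  (fun x v => (dual_poly a fs x).[v%:R]) (dual_norm2_gt0 a_gt0 fs_uniq node_ge0)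
  (dual_poly_orthogonality a_gt0 fs_uniq node_ge0)
  (dual_weight_ge0 a_gt0 node_ge0) approximable_dual_delta v v' rv rv'.
by apply: eq_sums => x; rewrite !horner_dual_poly.
Qed.

Lemma casorati_norm x :
  sums (fun v => dual_weight a fs v * \det (kernel_mx a (v :: fs) x) ^+ 2)
       (dual_norm2 a fs x).
Proof.
have := @dual_poly_orthogonality _ _ a_gt0 _ fs_uniq node_ge0 x x.
by rewrite eqxx; apply: eq_sums => v; rewrite horner_dual_poly.
Qed.

End Duality.

(** * Exceptional Charlier polynomials *)

Section Admissible.
Variable R : realType.
Implicit Types (F A B Y : {fset nat}) (v : nat).

Definition node_value F v : R := \prod_(f <- F) (v%:R - f%:R).

Lemma node_valueU A B v : fdisjoint A B ->
  node_value (A `|` B)%fset v = node_value A v * node_value B v.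
Proof.
move=> AB; rewrite /node_value -big_cat; apply: perm_big.
apply: uniq_perm; first exact: fset_uniq.
  rewrite cat_uniq !fset_uniq /= andbT; apply/hasPn => x xB.
  by move/fdisjointP_sym: AB => /(_ _ xB).
by move=> x; rewrite mem_cat in_fsetU.
Qed.

(** Below the block the factors are negative and even in number, above it all are positive, and
    inside it one of them is zero. *)
Lemma node_value_consecutive Y v : consecutive Y -> ~~ odd #|` Y| ->
  0 <= node_value Y v.
Proof.
move=> [m [M [mM YE]]] Yeven; rewrite /node_value.
have [vm|mv] := ltnP v m.
  have -> : \prod_(f <- Y) (v%:R - f%:R) =
    \prod_(f <- Y) (- 1 * (f%:R - v%:R)) :> R.
    by apply: eq_bigr => f _; rewrite mulN1r opprB.
  rewrite big_split /= big_const_seq count_predT iter_mulr_1.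
  rewrite -signr_odd -[size _]/(#|` Y|) (negbTE Yeven) mul1r.
  rewrite big_seq prodr_ge0 // => f; rewrite YE => /andP[mf _].
  by rewrite subr_ge0 ler_nat (leq_trans (ltnW vm)).
have [Mv|vM] := ltnP M v.
  rewrite big_seq prodr_ge0 // => f; rewrite YE => /andP[_ fM].
  by rewrite subr_ge0 ler_nat (leq_trans fM) // ltnW.
rewrite (big_rem v) /=; last by rewrite YE mv vM.
by rewrite subrr mul0r.
Qed.

Lemma node_poly_elements F v :
  (node_poly R (elements F)).[v%:R] = node_value F v.
Proof.
rewrite /node_poly horner_prod /node_value.
rewrite (perm_big F) /=; last by rewrite perm_sort.
by apply: eq_bigr => f _; rewrite hornerXsubC.
Qed.

Lemma admissible_ge0 F v : admissible F ->
  0 <= (node_poly R (elements F)).[v%:R].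
Proof.
move=> [K [Y [-> Ydisj Ycons _ Yeven]]]; rewrite node_poly_elements.
suff : forall j, (j <= K)%N ->
    0 <= node_value (\big[@fsetU nat/fset0]_(i < j) Y i) v by apply.
elim=> [|j IH] jK; first by rewrite big_ord0 /node_value big_nil.
rewrite big_ord_recr /= node_valueU.
  by apply: mulr_ge0; [exact/IH/ltnW|apply: node_value_consecutive; auto].
apply/fdisjointP => x /bigfcupP[i _ xi].
by apply: (fdisjointP (Ydisj i j _)) xi; rewrite ltn_ord jK.
Qed.

End Admissible.

(** * Orthogonality and density for the exceptional polynomials *)

Section Exceptional.
Variables (R : realType) (a : R) (F : {fset nat}).
Hypothesis a_gt0 : 0 < a.
Hypothesis F_adm : admissible F.
Implicit Types (v x n : nat).

Let fs := elements F.
Let fs_uniq : uniq fs. Proof. by rewrite sort_uniq fset_uniq. Qed.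
Let fsE v : (v \in fs) = (v \in F). Proof. exact: mem_sort. Qed.
Let node_ge0 v : 0 <= (node_poly R fs).[v%:R] := admissible_ge0 R v F_adm.

Let normalization2_gt0 s : 0 < normalization a s ^+ 2.
Proof. by rewrite exprn_even_gt0 //= normalization_neq0. Qed.

(** Shifting the index by [u_ F] lets [v] range over the complement of [F] in place of [sigma F]. *)
Definition exc_value v x : R := (exc_charlier a F (u_ F + v)).[x%:R].

Definition weight_ratio : R :=
  expR a / (a ^+ size fs * normalization a fs ^+ 2).

Definition exc_norm2 v : R :=
  weight_ratio * normalization a (v :: fs) ^+ 2 / dual_weight a fs v.

Lemma weight_ratio_gt0 : 0 < weight_ratio.
Proof.
by rewrite divr_gt0 ?expR_gt0 // mulr_gt0 ?normalization2_gt0 ?exprn_gt0.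
Qed.

(** The two determinants in the dual norm are, up to normalization, Omega at x and at x+1, so omega
    is a constant multiple of the inverse dual norms. *)
Lemma omega_weightE x : omega_weight a F x = weight_ratio / dual_norm2 a fs x.
Proof.
rewrite /omega_weight /Omega !horner_casorati // -/fs /weight_ratio /dual_norm2.
have n0 := normalization_neq0 a_gt0 fs.
have d0 y := kernel_det_neq0 a_gt0 fs_uniq node_ge0 y.
have e0 : expR a != 0 by rewrite gt_eqF ?expR_gt0.
have k0 : a ^+ size fs != 0 by rewrite expf_neq0 ?gt_eqF.
have x0 : a ^+ x != 0 by rewrite expf_neq0 ?gt_eqF.
rewrite /poisson; have f0 := fact_neq0 R x.
by field; rewrite !d0 n0 e0 k0 x0 f0.
Qed.

Lemma omega_weight_gt0 x : 0 < omega_weight a F x.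
Proof.
by rewrite omega_weightE divr_gt0 ?weight_ratio_gt0 ?dual_norm2_gt0.
Qed.

Lemma exc_valueE v x : exc_value v x =
  normalization a (v :: fs) * \det (kernel_mx a (v :: fs) x).
Proof. by rewrite /exc_value /exc_charlier addKn horner_casorati. Qed.

Lemma exc_norm2_gt0 v : v \notin F -> 0 < exc_norm2 v.
Proof.
rewrite -fsE -(dual_weight_gt0 a_gt0 node_ge0) => rv.
by rewrite divr_gt0 // mulr_gt0 ?weight_ratio_gt0.
Qed.

Lemma exc_value_orthogonality v v' : v \notin F -> v' \notin F ->
  sums (fun x => omega_weight a F x * (exc_value v x * exc_value v' x))
       (if v == v' then exc_norm2 v else 0).
Proof.
rewrite -!fsE => vF v'F.
have := casorati_orthogonality a_gt0 fs_uniq node_ge0 vF v'F.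
move=> /(sumsZ (weight_ratio * normalization a (v :: fs) *
  normalization a (v' :: fs))).
rewrite (_ : _ * (if _ then _ else _) = if v == v' then exc_norm2 v else 0).
  by apply: eq_sums => x; rewrite omega_weightE !exc_valueE; ring.
case: eqP => [<-|]; last by rewrite mulr0.
by rewrite /exc_norm2; ring.
Qed.

(** The Parseval identity required for a point mass at [x0] is the norm of D(., x0) in the dual
    space, rescaled. *)
Lemma approximable_exc_delta x0 :
  approximable (omega_weight a F) (span [set v | v \notin F] exc_value)
    (delta R x0).
Proof.
have r0 := dual_weight_ge0 a_gt0 node_ge0.
have c0 := weight_ratio_gt0.
have exc_norm2V v : (exc_norm2 v)^-1 =
    dual_weight a fs v * (weight_ratio * normalization a (v :: fs) ^+ 2)^-1.
  by rewrite /exc_norm2 invf_div.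
(* The dual weight vanishes exactly on [F], so the index set of positive inverse norms is the
   complement of [F]. *)
have Vgt0 v : (0 < (exc_norm2 v)^-1) = (v \notin F).
  rewrite exc_norm2V pmulr_lgt0 ?(dual_weight_gt0 a_gt0 node_ge0) ?fsE //.
  by rewrite invr_gt0 mulr_gt0.
have : approximable (omega_weight a F)
    (span [set v | 0 < (exc_norm2 v)^-1] exc_value) (delta R x0).
  apply: approximable_delta.
  - by move=> x; rewrite ltW ?omega_weight_gt0.
  - exact: omega_weight_gt0.
  - move=> v; rewrite exc_norm2V mulr_ge0 // invr_ge0 mulr_ge0 ?sqr_ge0 //.
    exact: ltW.
  - move=> v v'; rewrite !Vgt0 invrK; exact: exc_value_orthogonality.
  rewrite omega_weightE invf_div.
  have := sumsZ weight_ratio^-1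
    (@casorati_norm _ _ a_gt0 _ fs_uniq node_ge0 x0).
  rewrite [_ * dual_norm2 _ _ _]mulrC.
  apply: eq_sums => v; rewrite exc_norm2V exc_valueE.
  have := normalization_neq0 a_gt0 (v :: fs) => ?.
  have : weight_ratio != 0 by rewrite gt_eqF.
  by move=> ?; field; apply/andP.
by apply: approximable_sub => g [M [c [c0' gE]]]; exists M, c; split => // v Av;
  apply: c0'; case: Av => [|Av]; [left|right; rewrite /= Vgt0].
Qed.

End Exceptional.

(** * Measures supported on the natural numbers *)

Section PointMasses.
Variables (R : realType) (c : nat -> R).
Hypothesis c_ge0 : forall x, 0 <= c x.
Local Notation T := (measurableTypeR R).
Implicit Types f g : T -> R.

Definition point_masses : {measure set T -> \bar R} :=
  mseries (fun x => mscale (NngNum (c_ge0 x)) (dirac (x%:R : T))) 0.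

Lemma integral_point_masses f l : measurable_fun [set: T] f ->
  (forall x, 0 <= f x) -> sums (fun x => c x * f x%:R) l ->
  (\int[point_masses]_x (f x)%:E = l%:E)%E.
Proof.
move=> mf f0 fl; have mf' : measurable_fun [set: T] (EFin \o f).
  exact/measurable_EFinP.
rewrite ge0_integral_measure_series //; last by move=> t _; rewrite lee_fin.
rewrite -(nneseries_sums fl); apply: eq_eseriesr => x _.
rewrite ge0_integral_mscale //; last by move=> t _; rewrite lee_fin.
by rewrite integral_dirac // diracT mul1e.
Qed.

Lemma sums_point_masses f : measurable_fun [set: T] f ->
  (forall x, 0 <= f x) -> (\int[point_masses]_x (f x)%:E < +oo)%E ->
  exists l, sums (fun x => c x * f x%:R) l.
Proof.
move=> mf f0; have mf' : measurable_fun [set: T] (EFin \o f).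
  exact/measurable_EFinP.
rewrite ge0_integral_measure_series //; last by move=> t _; rewrite lee_fin.
move=> foo; apply: sums_nneseries => [x|]; first by rewrite mulr_ge0.
rewrite (eq_eseriesr (g := fun x => (c x * f x%:R)%:E)) // in foo.
move=> x _; rewrite ge0_integral_mscale //; last by move=> t _; rewrite lee_fin.
by rewrite integral_dirac // diracT mul1e.
Qed.

Lemma measurable_sqr f : measurable_fun [set: T] f ->
  measurable_fun [set: T] (fun x => f x ^+ 2).
Proof. by move=> mf; apply: measurable_funX. Qed.

Lemma Lnorm2_point_masses f l : measurable_fun [set: T] f ->
  sums (fun x => c x * f x%:R ^+ 2) l ->
  ('N[point_masses]_2%:E[EFin \o f] = (Num.sqrt l)%:E)%E.
Proof.
move=> mf fl; rewrite Lnorm.unlock /=.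
rewrite (eq_integral (fun x => (f x ^+ 2)%:E)) => [|x _]; last first.
  by rewrite (powR_mulrn 2) // real_normK ?num_real.
rewrite (integral_point_masses (measurable_sqr mf) _ fl); last first.
  by move=> x; exact: sqr_ge0.
rewrite poweR_EFin powR12_sqrt //; apply: sums_ge0 fl => x.
by rewrite mulr_ge0 ?sqr_ge0.
Qed.

(** Reduces membership in L2 to measurability and convergence of a series, so that the l2 results
    apply. *)
Lemma Lfun2_point_masses f : f \in Lfun point_masses 2%:E <->
  measurable_fun [set: T] f /\
  exists l, sums (fun x => c x * f x%:R ^+ 2) l.
Proof.
split=> [fL|[mf [l fl]]].
  have mf : measurable_fun [set: T] f.
    by have /andP[/[!inE]] := fL.
  split => //; have /integrableP[_] := Lfun2_integrable_sqr fL.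
  rewrite (eq_integral (fun x => (f x ^+ 2)%:E)) => [foo|x _]; last first.
    by rewrite /= ger0_norm ?sqr_ge0.
  apply: (sums_point_masses (f := fun x => f x ^+ 2)) => //.
    exact: measurable_sqr.
  by move=> x; exact: sqr_ge0.
apply/andP; split; rewrite inE //= /finite_norm.
by rewrite (Lnorm2_point_masses mf fl) ltry.
Qed.

Lemma sums_sqr_comb (f g : nat -> R) l l' s t :
  sums (fun x => c x * f x ^+ 2) l -> sums (fun x => c x * g x ^+ 2) l' ->
  exists l'', sums (fun x => c x * (s * f x + t * g x) ^+ 2) l''.
Proof.
move=> fl gl; apply: sums_le (sumsD (sumsZ (2 * s ^+ 2) fl)
  (sumsZ (2 * t ^+ 2) gl)) => x.
rewrite mulr_ge0 ?sqr_ge0 //= -subr_ge0.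
have -> : 2 * s ^+ 2 * (c x * f x ^+ 2) + 2 * t ^+ 2 * (c x * g x ^+ 2) -
  c x * (s * f x + t * g x) ^+ 2 = c x * (s * f x - t * g x) ^+ 2 by ring.
by rewrite mulr_ge0 ?sqr_ge0.
Qed.

(* Polarization reduces to integrals of squares. *)
Lemma integral_point_massesM f g l l' m :
  measurable_fun [set: T] f ->
  measurable_fun [set: T] g ->
  sums (fun x => c x * f x%:R ^+ 2) l -> sums (fun x => c x * g x%:R ^+ 2) l' ->
  sums (fun x => c x * (f x%:R * g x%:R)) m ->
  (\int[point_masses]_x (f x * g x)%:E = m%:E)%E.
Proof.
move=> mf mg fl gl fgm.
have H (s : R) : exists h : T -> R, [/\ measurable_fun [set: T] h,
    forall x, 0 <= h x, forall x, h x = (f x + s * g x) ^+ 2 &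
    sums (fun x => c x * h x%:R) (l + 2 * s * m + s ^+ 2 * l')].
  exists (fun x => (f x + s * g x) ^+ 2); split => //.
  - apply: measurable_sqr; apply: measurable_funD => //.
    by apply: measurable_funM.
  - by move=> x; exact: sqr_ge0.
  - apply: eq_sums (sumsD (sumsD fl (sumsZ (2 * s) fgm)) (sumsZ (s ^+ 2) gl)).
    by move=> x; ring.
(* The squares of f + g and f - g; a quarter of their difference is f g. *)
have [p [mp p0 pE pl]] := H 1; have [q [mq q0 qE ql]] := H (-1).
have quarter (h : T -> R) lh : measurable_fun [set: T] h ->
    (forall x, 0 <= h x) -> sums (fun x => c x * h x%:R) lh ->
    (\int[point_masses]_x (4^-1 * h x)%:E = (4^-1 * lh)%:E)%E /\
    point_masses.-integrable setT (EFin \o (fun x => 4^-1 * h x)).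
  move=> mh h0 hl.
  have mh' : measurable_fun [set: T] (fun x => 4^-1 * h x).
    by apply: measurable_funM.
  have h0' x : 0 <= 4^-1 * h x by rewrite mulr_ge0.
  have int : (\int[point_masses]_x (4^-1 * h x)%:E = (4^-1 * lh)%:E)%E.
    apply: (integral_point_masses mh' h0').
    by apply: eq_sums (sumsZ 4^-1 hl) => x; ring.
  split => //; apply/integrableP; split; first exact/measurable_EFinP.
  rewrite (eq_integral (fun x => (4^-1 * h x)%:E)) => [|x _].
    by rewrite int ltry.
  by rewrite /= ger0_norm.
have [intp ip] := quarter _ _ mp p0 pl; have [intq iq] := quarter _ _ mq q0 ql.
rewrite (eq_integral
  (fun x => (4^-1 * p x)%:E - (4^-1 * q x)%:E)%E); last first.
  by move=> x _; rewrite -EFinB pE qE; congr _%:E; field.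
rewrite integralB_EFin // intp intq -EFinB; congr _%:E; by field.
Qed.

End PointMasses.

(** * Completeness and orthogonality *)

Section Completeness.
Variables (R : realType) (a : R) (F : {fset nat}).
Hypothesis a_gt0 : 0 < a.
Hypothesis F_adm : admissible F.
Local Notation T := (measurableTypeR R).

Let omega_ge0 x : 0 <= omega_weight a F x.
Proof. by rewrite ltW ?omega_weight_gt0. Qed.

Let mu : {measure set T -> \bar R} := point_masses omega_ge0.

Lemma sigmaP n : sigma F n ->
  exists2 v, v \notin F & n = (u_ F + v)%N.
Proof.
move=> [un nF]; exists (n - u_ F)%N; last by rewrite subnKC.
by apply/negP => vF; apply: nF; exists (n - u_ F)%N; rewrite //= subnKC.
Qed.

Lemma sigma_shift v : v \notin F -> sigma F (u_ F + v)%N.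
Proof.
move=> vF; split; first exact: leq_addr.
by move=> [f fF /addnI fv]; move: vF; rewrite -fv fF.
Qed.

Lemma sums_exc m n : sigma F m -> sigma F n ->
  sums (fun x : nat => omega_weight a F x *
      ((exc_charlier a F m).[x%:R] * (exc_charlier a F n).[x%:R]))
    (if m == n then exc_norm2 a F (n - u_ F) else 0).
Proof.
move=> /sigmaP[v vF ->] /sigmaP[v' v'F ->]; rewrite addKn eqn_add2l.
have := exc_value_orthogonality a_gt0 F_adm vF v'F.
by case: eqP => [->|].
Qed.

Lemma sums_sqr_linear_combination q :
  linear_combinations (sigma F) (exc_charlier a F) q ->
  exists l, sums (fun x : nat => omega_weight a F x * q.[x%:R] ^+ 2) l.
Proof.
move=> [s [c [sF ->]]]; elim: s sF => [_|n s IH sF].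
  exists 0; apply: eq_sums (@sums0 R) => x.
  by rewrite big_nil horner0 expr0n mulr0.
have [l sl] : exists l, sums (fun x : nat => omega_weight a F x *
    (\sum_(n <- s) c n *: exc_charlier a F n).[x%:R] ^+ 2) l.
  by apply: IH => m ms; apply: sF; rewrite /= inE ms orbT.
have nF : sigma F n by apply: sF; rewrite /= inE eqxx.
have [l' l'P] := sums_sqr_comb omega_ge0 (c n) 1 (sums_exc nF nF) sl.
exists l'; apply: eq_sums l'P => x.
by rewrite big_cons hornerD hornerZ mul1r.
Qed.

Lemma span_linear_combination g : span [set v | v \notin F] (exc_value a F) g ->
  exists2 q, linear_combinations (sigma F) (exc_charlier a F) q &
    forall x : nat, g x = q.[x%:R].
Proof.
move=> [M [c [c0 gE]]].
exists (\sum_(v <- iota 0 M | v \notin F) c v *: exc_charlier a F (u_ F + v)).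
  exists [seq (u_ F + v)%N | v <- iota 0 M & v \notin F],
    (fun n => c (n - u_ F)%N).
  split.
    move=> n /= /mapP[v]; rewrite mem_filter => /andP[vF _] ->.
    exact: sigma_shift.
  by rewrite big_map big_filter; apply: eq_bigr => v _; rewrite addKn.
move=> x; rewrite gE horner_sum [RHS]big_mkcond -[M in iota 0 M]subn0 big_mkord.
apply: eq_bigr => v _; case: ifPn => [vF|/negPn vF]; first by rewrite hornerZ.
by rewrite c0 ?mul0r //; right => /=; rewrite vF.
Qed.

Lemma complete_exc_charlier :
  complete_system mu (sigma F) (exc_charlier a F).
Proof.
split=> [q /sums_sqr_linear_combination qS|f].
  by apply/Lfun2_point_masses; split => //; exact: measurable_poly.
move=> /Lfun2_point_masses[mf [l fl]] e e0.
(* Partial sums give only a non-strict bound on the squared error; halving e^2 makes the final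
   inequality strict. *)
have e2 : 0 < e ^+ 2 / 2 by rewrite divr_gt0 // exprn_gt0.
have [g gS ge] := approximable_l2 omega_ge0 (@spanD _ _ _) (@spanZ _ _ _)
  (span0 _ _) (approximable_exc_delta a_gt0 F_adm) fl e2.
have [q qS gq] := span_linear_combination gS.
exists q => //; have [lq qlq] := sums_sqr_linear_combination qS.
have [d fqd] := sums_sqr_comb omega_ge0 1 (-1) fl qlq.
have dE : sums (fun x : nat => omega_weight a F x * (f x%:R - q.[x%:R]) ^+ 2) d.
  by apply: eq_sums fqd => x; rewrite mul1r mulN1r.
have mfq : measurable_fun [set: T] (fun x : T => f x - q.[x]).
  by apply: measurable_funB => //; exact: measurable_poly.
have := Lnorm2_point_masses omega_ge0 mfq dE; rewrite /comp => ->.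
have de : d <= e ^+ 2 / 2.
  by apply: sums_le_bound dE => n; have := ge n; under eq_bigr do rewrite gq.
rewrite lte_fin -[ltRHS](ger0_norm (ltW e0)) -sqrtr_sqr ltr_sqrt ?exprn_gt0 //.
by apply: le_lt_trans de _; lra.
Qed.

Lemma orthogonal_exc_charlier :
  orthogonal_system mu (sigma F) (exc_charlier a F).
Proof.
have mp (p : {poly R}) : measurable_fun [set: T] (horner p).
  exact: measurable_poly.
have norm n : sigma F n -> sums (fun x : nat => omega_weight a F x *
    (exc_charlier a F n).[x%:R] ^+ 2) (exc_norm2 a F (n - u_ F)).
  by move=> nF; have := sums_exc nF nF; rewrite eqxx.
split=> [n nF|m n mF nF mn|n nF].
- apply/Lfun2_point_masses; split => //.
  by exists (exc_norm2 a F (n - u_ F)); exact: norm.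
- apply: (integral_point_massesM omega_ge0 (mp _) (mp _)
    (norm _ mF) (norm _ nF)).
  by have := sums_exc mF nF; case: eqP.
- rewrite (integral_point_masses omega_ge0
    (f := fun x => (exc_charlier a F n).[x] ^+ 2)
    _ _ (norm _ nF)).
  + have [v vF ->] := sigmaP nF.
    by rewrite addKn gt_eqF // lte_fin exc_norm2_gt0.
  + exact: measurable_sqr.
  + by move=> x; exact: sqr_ge0.
Qed.

End Completeness.

Theorem theorem4p5 (R : realType) (a : R) (F : {fset nat})
    (a_gt0 : 0 < a) (F_pos : forall f, f \in F -> (0 < f)%N)
    (F_adm : admissible F) :
  (forall x : nat, 0 < omega_weight a F x) /\
  exists2 mu : {measure set (measurableTypeR R) -> \bar R},
    (forall A : set R, mu A = omega a F A) &
    complete_system mu (sigma F) (exc_charlier a F) /\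
    orthogonal_system mu (sigma F) (exc_charlier a F).
Proof.
split; first exact: omega_weight_gt0.
(* The measure is fixed by unification with the completeness and orthogonality results; its values
   then agree with [omega] by conversion. *)
eexists; last first.
  by split; [exact: complete_exc_charlier|exact: orthogonal_exc_charlier].
by [].
Qed.
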